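(* Let $d\in\mathbb N\cup\{\infty\}$ and let $h\in H^2_d$. Then there exist $a,b\in Mult(H^2_d)$ such that: (i) $a$ is $H^2_d$-outer, i.e. $aH^2_d$ is dense in $H^2_d$; (ii) $h(z)=\dfrac{b(z)}{a(z)}$ for all $z\in\mathbb B^d$; (iii) the column $\begin{pmatrix} a\\ b\end{pmatrix}$ is a contractive multiplier, i.e. $\|af\|^2+\|bf\|^2\le\|f\|^2$ for all $f\in H^2_d$; (iv) $1/a\in H^2_d$, with $\|1/a\|^2_{H^2_d}\le 1+\|h\|^2_{H^2_d}$.
   Context: $\mathbb B^d$ is the open unit ball of $\mathbb C^d$ (of $\ell^2(\mathbb N)$ if $d=\infty$). The Drury-Arveson space $H^2_d$ is the reproducing kernel Hilbert space of holomorphic functions on $\mathbb B^d$ with kernel $k(z,w)=(1-zw^* )^{-1}$, where $zw^*=\sum_j z_j\overline{w_j}$. $Mult(H^2_d)$ is the algebra of functions $b$ on $\mathbb B^d$ such that $bf\in H^2_d$ for all $f\in H^2_d$ (and then $f\mapsto bf$ is bounded). *)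

(* Defs.v *)
From HB Require Import structures.
From mathcomp Require Import all_boot all_order all_algebra.
From mathcomp Require Import complex.
From mathcomp Require Import all_classical all_reals all_analysis.

Set Implicit Arguments.
Unset Strict Implicit.
Unset Printing Implicit Defensive.

Import Order.TTheory GRing.Theory Num.Theory.
Import numFieldNormedType.Exports.

Local Open Scope classical_set_scope.
Local Open Scope ring_scope.
Local Open Scope complex_scope.

Definition dot_norm (R : realType) (T : Type)
    (dot : (T -> R[i]) -> (T -> R[i]) -> R[i]) (f : T -> R[i]) : R :=
  Num.sqrt (complex.Re (dot f f)).

(** Reproducing kernel Hilbert spaces.  By the Moore-Aronszajn theorem the set
    of functions and the inner product (on that set) are determined by the
    kernel, so that an inhabitant of [rkhs k] is "the" RKHS with kernel [k].
    The inner product is linear in its first argument; its values outside of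
    the carrier are irrelevant. *)
Record rkhs (R : realType) (T : Type) (k : T -> T -> R[i]) := RKHS {
  carrier : set (T -> R[i]);
  dot : (T -> R[i]) -> (T -> R[i]) -> R[i];
  rkhs0 : carrier (fun=> 0);
  rkhsDZ : forall (c : R[i]) f g,
    carrier f -> carrier g -> carrier (fun x => c * f x + g x);
  dotDZl : forall (c : R[i]) f g u, carrier f -> carrier g -> carrier u ->
    dot (fun x => c * f x + g x) u = c * dot f u + dot g u;
  dotC : forall f g, carrier f -> carrier g -> dot f g = (dot g f)^*;
  dot_ge0 : forall f, carrier f -> 0 <= dot f f;
  dot_eq0 : forall f, carrier f -> dot f f = 0 -> f = (fun=> 0);
  rkhs_complete : forall u : nat -> T -> R[i],
    (forall n, carrier (u n)) ->
    (forall e : R, 0 < e -> exists N : nat, forall m n : nat,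
       (N <= m)%N -> (N <= n)%N ->
       dot_norm dot (fun x => u m x - u n x) < e) ->
    exists2 l, carrier l &
      dot_norm dot (fun x => u n x - l x) @[n --> \oo] --> (0 : R);
  rkhs_kernel : forall w, carrier (fun z => k z w);
  rkhs_reproducing : forall f w, carrier f -> dot f (fun z => k z w) = f w
}.

Definition hnorm (R : realType) (T : Type) (k : T -> T -> R[i])
    (H : rkhs k) (f : T -> R[i]) : R := dot_norm (dot H) f.

Definition Mult (R : realType) (T : Type) (k : T -> T -> R[i])
    (H : rkhs k) : set (T -> R[i]) :=
  [set b | forall f, carrier H f -> carrier H (fun z => b z * f z)].

Definition outer (R : realType) (T : Type) (k : T -> T -> R[i])
    (H : rkhs k) (a : T -> R[i]) : Prop :=
  forall g, carrier H g -> forall e : R, 0 < e ->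
    exists2 f, carrier H f & hnorm H (fun z => a z * f z - g z) < e.

(** The dimension is [Some n] for a natural number [n] and [None] for infinity.
    C^n is identified with the sequences supported on the first [n] indices. *)
Definition in_dim (d : option nat) (j : nat) : bool :=
  if d is Some n then (j < n)%N else true.

Definition ball_set (R : realType) (d : option nat) : set (nat -> R[i]) :=
  [set z | (forall j, ~~ in_dim d j -> z j = 0) /\
           (\sum_(0 <= j <oo)
              ((complex.Re (z j) ^+ 2 + complex.Im (z j) ^+ 2)%:E)
            < 1%:E)%E].

Definition cball (R : realType) (d : option nat) : Type :=
  set_type (@ball_set R d).

Definition pairing (R : realType) (z w : nat -> R[i]) : R[i] :=
  limn (fun n : nat => \sum_(0 <= j < n) z j * (w j)^* : R[i]^o).

(** The kernel determines the whole structure [rkhs (@da_kernel R d)], the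
    Drury-Arveson space; holomorphy of its elements is automatic. *)
Definition da_kernel (R : realType) (d : option nat) (z w : cball R d) : R[i] :=
  (1 - pairing (set_val z) (set_val w))^-1.

(* Main.v *)
(** Lift [h] to the full Fock space [F] = l2(words), whose evaluation at points
    of the ball is a coisometry onto the Drury-Arveson space. Among the pairs
    [(q, q h)] with [q] in [F] (noncommutative product), the component of
    [(1, h)] orthogonal to those whose [q] has no constant term is, once
    normalized, a pair [w = (a, a h)] that is orthogonal to all its proper left
    shifts [L_c w]. As the [L_c] are isometries with orthogonal ranges, the
    [L_c w] are orthonormal, so that [p |-> p w] is isometric on [F]: evaluating,
    [(a, b)] with [b = a h] is a contractive column multiplier.
    Let [g w] be the projection of [(1, h)] to the closed span of the [L_c w].
    The remainder has the form [(r, r h)] and is orthogonal to all [L_c w];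
    induction on words gives [r = 0]. Hence [g a = 1] and [g (a h) = h], with
    [|g|^2 <= |(1, h)|^2 = 1 + |h|^2]. Finally [a] is outer because [a g p = p]
    for every polynomial [p]. *)
Require Import Defs.
From HB Require Import structures.
From mathcomp Require Import all_boot all_order all_algebra.
From mathcomp Require Import complex.
From mathcomp Require Import finmap.
From mathcomp Require Import all_classical all_reals all_analysis.
From mathcomp.analysis.showcase Require Import summability.
From mathcomp Require Import ring lra.

Set Implicit Arguments.
Unset Strict Implicit.
Unset Printing Implicit Defensive.

Import Order.TTheory GRing.Theory Num.Theory.
Import numFieldNormedType.Exports.

Local Open Scope classical_set_scope.
Local Open Scope ring_scope.
Local Open Scope complex_scope.

(* Without this, [x ^*] is [Num.conj] inside ring expressions, but [conjc]
   elsewhere, and the two do not match syntactically. *)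
Local Notation "x ^*" := (conjc x) : ring_scope.

(** * Limits of complex families *)

Section complex_limits.
Context {R : realType} {I : Type} {F : set_system I} {FF : ProperFilter F}.
Implicit Types (u v : I -> R[i]) (a b : R[i]).

Definition ccvg (G : set_system I) u a : Prop :=
  (u : I -> R[i]^o) @ G --> (a : R[i]^o).

(** A positive element of [R[i]] is real, so it is enough to test real radii. *)
Lemma ccvgP u a : ccvg F u a <->
  forall e : R, 0 < e -> \forall n \near F, `|a - u n| < e%:C.
Proof.
split=> [/cvgrPdist_lt h e e0|h]; first by apply: h; rewrite ltcR.
apply/cvgrPdist_lt => e; rewrite ltcE => /andP[/eqP /= i0 e0].
by have := h _ e0; congr (nbhs _ _); apply/funext => n; case: e i0 e0 => x y /= ->.
Qed.

Lemma ccvg_unique u a b : ccvg F u a -> ccvg F u b -> a = b.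
Proof. by move=> /cvg_unique h /h; apply. Qed.

Lemma ccvg_cst a : ccvg F (fun=> a) a.
Proof. exact: cvg_cst. Qed.
Arguments ccvg_cst a : clear implicits.

Lemma ccvgD u v a b :
  ccvg F u a -> ccvg F v b -> ccvg F (fun n => u n + v n) (a + b).
Proof. exact: cvgD. Qed.

Lemma ccvgB u v a b :
  ccvg F u a -> ccvg F v b -> ccvg F (fun n => u n - v n) (a - b).
Proof. exact: cvgB. Qed.

Lemma ccvgM u v a b :
  ccvg F u a -> ccvg F v b -> ccvg F (fun n => u n * v n) (a * b).
Proof. exact: cvgM. Qed.

Lemma ccvgV u a : a != 0 -> ccvg F u a -> ccvg F (fun n => (u n)^-1) a^-1.
Proof. by move=> a0 h; apply: (@cvgV R[i]). Qed.

Lemma ccvgJ u a : ccvg F u a -> ccvg F (fun n => (u n)^*) a^*.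
Proof.
move=> /ccvgP h; apply/ccvgP => e /h; apply: filterS => n.
by rewrite -rmorphB normcJ.
Qed.

Lemma ccvg_real (u : I -> R) (a : R) :
  u @ F --> a -> ccvg F (fun n => (u n)%:C) a%:C.
Proof.
move=> /cvgrPdist_lt h; apply/ccvgP => e /h; apply: filterS => n.
rewrite -rmorphB normc_def ltcR /= expr0n addr0 sqrtr_sqr; exact.
Qed.

Lemma ccvg_Re u a : ccvg F u a -> complex.Re (u n) @[n --> F] --> complex.Re a.
Proof.
move=> /ccvgP h; apply/cvgrPdist_lt => e /h; apply: filterS => n.
move=> /(le_lt_trans (normc_ge_Re _)); rewrite ltcR.
by case: a {h} (u n) => [x y] [x' y'].
Qed.

Lemma ccvg_ReIm u (x y : R) :
  complex.Re (u n) @[n --> F] --> x -> complex.Im (u n) @[n --> F] --> y ->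
  ccvg F u (x +i* y).
Proof.
move=> /ccvg_real hx /ccvg_real hy.
have := ccvgD hx (ccvgM (ccvg_cst ('i%C : R[i])) hy).
rewrite -(complexE (x +i* y)); congr (ccvg F _ _).
by apply/funext => n; rewrite -complexE.
Qed.

Lemma eq_ccvg u v a : u =1 v -> ccvg F u a -> ccvg F v a.
Proof. by move=> /funext ->. Qed.

End complex_limits.
Arguments ccvg_cst {R I F FF} a.

(** * Reproducing kernel Hilbert spaces *)

Section rkhs_theory.
Context {R : realType} {T : Type} {k : T -> T -> R[i]} (H : rkhs k).
Implicit Types (f g u v : T -> R[i]) (c : R[i]).
Local Notation dot := (dot H).
Local Notation mem := (carrier H).
Local Notation nrm := (hnorm H).

Lemma mem_lin c f g : mem f -> mem g -> mem (c *: f + g).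
Proof. exact: rkhsDZ. Qed.

Lemma mem0 : mem 0.
Proof. exact: rkhs0. Qed.

Lemma memD f g : mem f -> mem g -> mem (f + g).
Proof. by move=> hf hg; rewrite -[f]scale1r; apply: mem_lin. Qed.

Lemma memZ c f : mem f -> mem (c *: f).
Proof. by move=> hf; rewrite -[X in mem X]addr0; apply: mem_lin => //; exact: mem0. Qed.

Lemma memN f : mem f -> mem (- f).
Proof. by move=> hf; rewrite -scaleN1r; apply: memZ. Qed.

Lemma memB f g : mem f -> mem g -> mem (f - g).
Proof. by move=> hf hg; apply: memD => //; apply: memN. Qed.

Lemma dot_linl c f g u : mem f -> mem g -> mem u ->
  dot (c *: f + g) u = c * dot f u + dot g u.
Proof. exact: dotDZl. Qed.

Lemma dotDl f g u : mem f -> mem g -> mem u -> dot (f + g) u = dot f u + dot g u.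
Proof. by move=> hf hg hu; rewrite -[f]scale1r dot_linl// mul1r scale1r. Qed.

Lemma dot0l u : mem u -> dot 0 u = 0.
Proof.
move=> hu; have := dotDl mem0 mem0 hu.
by rewrite addr0 => /(congr1 (fun x => x - dot 0 u)); rewrite subrr addrK.
Qed.

Lemma dotZl c f u : mem f -> mem u -> dot (c *: f) u = c * dot f u.
Proof.
move=> hf hu; rewrite -[c *: f]addr0 dot_linl//; last exact: mem0.
by rewrite dot0l// addr0.
Qed.

Lemma dotNl f u : mem f -> mem u -> dot (- f) u = - dot f u.
Proof. by move=> hf hu; rewrite -scaleN1r dotZl// mulN1r. Qed.

Lemma dotBl f g u : mem f -> mem g -> mem u -> dot (f - g) u = dot f u - dot g u.
Proof. by move=> hf hg hu; rewrite dotDl ?dotNl//; apply: memN. Qed.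

Lemma dotDr f g u : mem f -> mem g -> mem u -> dot u (f + g) = dot u f + dot u g.
Proof.
move=> hf hg hu; rewrite dotC ?dotDl//; last exact: memD.
by rewrite rmorphD/= -!dotC.
Qed.

Lemma dotZr c f u : mem f -> mem u -> dot u (c *: f) = c^* * dot u f.
Proof.
move=> hf hu; rewrite dotC ?dotZl//; last exact: memZ.
by rewrite rmorphM/= -dotC.
Qed.

Lemma dotNr f u : mem f -> mem u -> dot u (- f) = - dot u f.
Proof. by move=> hf hu; rewrite dotC ?dotNl ?rmorphN/= -?dotC//; apply: memN. Qed.

Lemma dotBr f g u : mem f -> mem g -> mem u -> dot u (f - g) = dot u f - dot u g.
Proof. by move=> hf hg hu; rewrite dotDr ?dotNr//; apply: memN. Qed.

Lemma dot0r u : mem u -> dot u 0 = 0.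
Proof. by move=> hu; rewrite dotC ?dot0l ?conjc0//; exact: mem0. Qed.

Lemma hnorm_ge0 f : 0 <= nrm f.
Proof. exact: sqrtr_ge0. Qed.
Hint Resolve hnorm_ge0 : core.

Lemma dot_hnorm f : mem f -> dot f f = (nrm f ^+ 2)%:C.
Proof.
move=> /dot_ge0 h; rewrite /hnorm /dot_norm sqr_sqrtr ?RRe_real ?ger0_real//.
by move: h; rewrite lecE => /andP[].
Qed.

Lemma dot_hnormX f : mem f -> dot f f = (nrm f)%:C ^+ 2.
Proof. by move=> /dot_hnorm ->; rewrite rmorphXn. Qed.

Lemma hnorm_Re f : mem f -> nrm f ^+ 2 = complex.Re (dot f f).
Proof. by move=> /dot_hnorm ->. Qed.

Lemma hnorm_eq0 f : mem f -> nrm f = 0 -> f = 0.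
Proof. by move=> hf h; apply: (dot_eq0 hf); rewrite dot_hnorm// h expr0n. Qed.

Lemma hnorm0 : nrm 0 = 0.
Proof. by rewrite /hnorm /dot_norm dot0l ?sqrtr0//; exact: mem0. Qed.

Lemma hnormZ c f : mem f -> (nrm (c *: f))%:C = `|c| * (nrm f)%:C.
Proof.
move=> hf; have hc := memZ c hf; apply/eqP; rewrite -(@eqrXn2 _ 2)//.
- by rewrite exprMn -!dot_hnormX// sqr_normc dotZl ?dotZr// mulrA.
- by rewrite ler0c.
- by apply: mulr_ge0; [exact: normr_ge0|rewrite ler0c].
Qed.

Lemma hnormN f : mem f -> nrm (- f) = nrm f.
Proof.
move=> hf; apply: complexI; rewrite -scaleN1r.
by rewrite hnormZ// normrN normr1 mul1r.
Qed.

Lemma cauchy_schwarz f g : mem f -> mem g -> `|dot f g| <= (nrm f * nrm g)%:C.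
Proof.
move=> hf hg; have [g0|g0] := eqVneq (nrm g) 0.
  by rewrite (hnorm_eq0 hg g0) dot0r// normr0 ler0c mulr_ge0.
rewrite -(@ler_pXn2r _ 2)// ?nnegrE ?ler0c ?mulr_ge0// rmorphM exprMn.
rewrite -!dot_hnormX//.
have gg : 0 < dot g g by rewrite dot_hnorm// ltcR exprn_gt0// lt_neqAle eq_sym g0/=.
(* [c *: g] is the component of [f] along [g]; positivity of the squared norm of [f - c *: g] is the
   wanted inequality. *)
pose c : R[i] := dot f g / dot g g.
have hc := memZ c hg; have hB := memB hf hc.
have := dot_ge0 hB; rewrite dotBl// !dotBr// !dotZl// !dotZr//.
rewrite [dot g f]dotC// => h.
have E : dot f f - c^* * dot f g - (c * (dot f g)^* - c * (c^* * dot g g)) =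
   dot f f - `|dot f g| ^+ 2 / dot g g.
  have -> : c^* = (dot f g)^* / dot g g by rewrite /c rmorphM/= conjc_inv -(dotC hg hg).
  rewrite sqr_normc /c.
  by field; rewrite gt_eqF.
by move: h; rewrite E subr_ge0 ler_pdivrMr.
Qed.

Lemma hnormD f g : mem f -> mem g -> nrm (f + g) <= nrm f + nrm g.
Proof.
move=> hf hg; rewrite -(@ler_pXn2r _ 2)// ?nnegrE ?addr_ge0//.
rewrite hnorm_Re; last exact: memD.
have hfg := memD hf hg.
rewrite dotDl// !dotDr// !raddfD/= -!hnorm_Re//.
have := cauchy_schwarz hf hg; move=> /(le_trans (normc_ge_Re _)); rewrite lecR.
have -> : complex.Re (dot g f) = complex.Re (dot f g).
  by rewrite dotC//; case: (dot f g).
by move=> /(le_trans (ler_norm _)) h; nra.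
Qed.

Lemma hnorm_distC f g : mem f -> mem g -> nrm (f - g) = nrm (g - f).
Proof. by move=> hf hg; rewrite -hnormN ?opprB//; exact: memB. Qed.

Lemma hnorm_tri g f u : mem f -> mem g -> mem u ->
  nrm (f - u) <= nrm (f - g) + nrm (g - u).
Proof.
move=> hf hg hu; have -> : f - u = (f - g) + (g - u) by rewrite addrA subrK.
by apply: hnormD; apply: memB.
Qed.

Lemma parallelogram f g : mem f -> mem g ->
  nrm (f + g) ^+ 2 + nrm (f - g) ^+ 2 = 2 * (nrm f ^+ 2 + nrm g ^+ 2).
Proof.
move=> hf hg; have hD := memD hf hg; have hB := memB hf hg.
rewrite !hnorm_Re// dotBl// !dotBr// dotDl// !dotDr// !(raddfD, raddfB) /=; ring.
Qed.

Definition hcvg (s : nat -> T -> R[i]) (l : T -> R[i]) : Prop :=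
  nrm (s n - l) @[n --> \oo] --> (0 : R).

Lemma hcvg_dist s l : mem l -> (forall n, mem (s n)) -> hcvg s l ->
  nrm (s n) @[n --> \oo] --> nrm l.
Proof.
move=> hl hs /cvgrPdist_lt h; apply/cvgrPdist_lt => e /h; apply: filterS => n.
rewrite sub0r normrN ger0_norm//; apply: le_lt_trans; rewrite ler_norml.
have := hnorm_tri hl (hs n) mem0; have := hnorm_tri (hs n) hl mem0.
by rewrite !subr0 (hnorm_distC hl)// => h1 h2; apply/andP; split; lra.
Qed.

Lemma hcvg_dot s l u : mem l -> (forall n, mem (s n)) -> mem u -> hcvg s l ->
  ccvg \oo (fun n => dot (s n) u) (dot l u).
Proof.
move=> hl hs hu h.
have h0 : nrm (s n - l) * nrm u @[n --> \oo] --> 0 * nrm u.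
  by apply: cvgM => //; exact: cvg_cst.
move: h0; rewrite mul0r => /cvgrPdist_lt h0.
apply/ccvgP => e /h0; apply: filterS => n.
rewrite sub0r normrN ger0_norm ?mulr_ge0// -ltcR; apply: le_lt_trans.
rewrite -dotBl// hnorm_distC//; apply: cauchy_schwarz => //; exact: memB.
Qed.

Lemma hcvg_eval s l x : mem l -> (forall n, mem (s n)) -> hcvg s l ->
  ccvg \oo (fun n => s n x) (l x).
Proof.
move=> hl hs h; have hk := rkhs_kernel H x.
rewrite -(rkhs_reproducing x hl); apply: eq_ccvg (hcvg_dot hl hs hk h) => n.
exact: rkhs_reproducing.
Qed.

Lemma hcomplete s : (forall n, mem (s n)) ->
  (forall e : R, 0 < e -> exists N : nat, forall m n : nat,
     (N <= m)%N -> (N <= n)%N -> nrm (s m - s n) < e) ->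
  exists2 l, mem l & hcvg s l.
Proof. exact: rkhs_complete. Qed.

Lemma hcvg_cauchy s l : mem l -> (forall n, mem (s n)) -> hcvg s l ->
  forall e : R, 0 < e -> exists N : nat, forall m n : nat,
     (N <= m)%N -> (N <= n)%N -> nrm (s m - s n) < e.
Proof.
move=> hl hs /cvgrPdist_lt h e e0.
have [N _ hN] := h _ (divr_gt0 e0 (ltr0n _ 2)).
have {}hN n : (N <= n)%N -> nrm (s n - l) < e / 2.
  by move=> /hN /=; rewrite sub0r normrN ger0_norm.
exists N => m n /hN hm /hN hn.
have := hnorm_tri (hs m) hl (hs n).
by rewrite [nrm (l - _)]hnorm_distC// => h1; lra.
Qed.

End rkhs_theory.
#[global] Hint Resolve hnorm_ge0 : core.

(** * Orthogonal projection onto the closure of a subspace *)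

Section projection.
Context {R : realType} {T : Type} {k : T -> T -> R[i]} (H : rkhs k).
Implicit Types (f g u v : T -> R[i]) (c : R[i]).
Local Notation dot := (dot H).
Local Notation mem := (carrier H).
Local Notation nrm := (hnorm H).

(** Subtracting [t * dot f w] times [w] changes the squared norm of [f] by
    [|dot f w|^2 (t^2 N - 2 t)], where [N] is the squared norm of [w]; minimality excludes a
    negative change. *)
Lemma orthogonal_of_min f w : mem f -> mem w ->
  (forall c, nrm f ^+ 2 <= nrm (f - c *: w) ^+ 2) -> dot f w = 0.
Proof.
move=> hf hw hmin; apply/eqP; apply/negPn/negP => c0.
have [N NE N0] : exists2 N, nrm w ^+ 2 = N & 0 <= N.
  by exists (nrm w ^+ 2) => //; exact: sqr_ge0.
have N1 : 0 < N + 1 by lra.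
(* With [t = 1 / (N + 1)] one gets [t^2 N - 2 t = - t - t^2], which is negative. *)
have [t t0 tN] : exists2 t, 0 < t & t * (N + 1) = 1.
  by exists (N + 1)^-1; rewrite ?invr_gt0 ?mulVf// gt_eqF.
pose c : R[i] := t%:C * dot f w.
have hc := memZ c hw; have hB := memB hf hc.
have := hmin c; rewrite [leRHS]hnorm_Re// dotBl// !dotBr// !dotZl// !dotZr//.
rewrite (dotC hw hf) (dot_hnorm hw) (dot_hnorm hf) NE /c.
move: c0; case: (dot f w) => a b c0.
rewrite /= => h.
have : 0 < a ^+ 2 + b ^+ 2.
  rewrite lt_neqAle addr_ge0 ?sqr_ge0// andbT eq_sym paddr_eq0 ?sqr_ge0// !sqrf_eq0.
  by move: c0; rewrite eq_complex.
move: h; set F := nrm f ^+ 2; move: F => F h ab0.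
have : 0 <= (a ^+ 2 + b ^+ 2) * (t * (t * N) - 2 * t).
  by move: h; rewrite -subr_ge0; congr (0 <= _); ring.
rewrite pmulr_rge0//; have -> : t * N = 1 - t by lra.
by nra.
Qed.

(** The projection [l] lies in the closure of [W], so it is returned with a minimizing sequence in
    [W], along which properties of members of [W] later pass to [l]. *)
Lemma projection (W : set (T -> R[i])) f : W `<=` mem -> W 0 ->
  (forall c f g, W f -> W g -> W (c *: f + g)) -> mem f ->
  exists l, exists2 s, [/\ mem l, (forall n, W (s n)) & hcvg H s l] &
    forall w, W w -> dot (f - l) w = 0.
Proof.
move=> WH W0 WL hf.
pose D := [set nrm (f - w) ^+ 2 | w in W]; pose d := inf D.
have D0 : D !=set0 by exists (nrm (f - 0) ^+ 2); exists 0.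
have lD : lbound D 0 by move=> _ [w _ <-]; exact: sqr_ge0.
have hD : has_inf D by split => //; exists 0.
have dW w : W w -> d <= nrm (f - w) ^+ 2.
  by move=> Ww; apply: ge_inf; [exists 0|exists w].
have /choice[s hs] : forall n : nat, exists w, W w /\ nrm (f - w) ^+ 2 < d + n.+1%:R^-1.
  move=> n; have n0 : 0 < n.+1%:R^-1 :> R by rewrite invr_gt0.
  by have [_ [w Ww <-] hw] := inf_adherent n0 hD; exists w.
have Ws n := (hs n).1; have ms n := WH _ (Ws n).
(* Parallelogram law: the midpoint [w] of [s m] and [s n] is in [W], so its squared distance to [f]
   is at least [d]. *)
have mid m n : nrm (s m - s n) ^+ 2 <= 2 * (m.+1%:R^-1 + n.+1%:R^-1).
  pose w : T -> R[i] := 2^-1 *: s m + (2^-1 *: s n + 0).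
  have Ww : W w by exact: (WL _ _ _ (Ws m) (WL _ _ _ (Ws n) W0)).
  have hfw := memB hf (WH _ Ww).
  have h1 := parallelogram (memB hf (ms n)) (memB hf (ms m)).
  have h2 := parallelogram hfw hfw; rewrite subrr hnorm0 expr0n addr0 in h2.
  have e1 : f - s n + (f - s m) = (f - w) + (f - w).
      apply/funext => x; rewrite /w addr0 !fctE /= /GRing.scale /=.
    by have two : 2 != 0 :> R[i] by []; field.
  have e2 : f - s n - (f - s m) = s m - s n.
    by rewrite opprB addrC addrA subrK.
  have := dW _ Ww; have := (hs m).2; have := (hs n).2.
  rewrite e1 e2 in h1; rewrite h2 in h1; move: h1.
  move: (nrm (f - w)) (nrm (s m - s n)) (nrm (f - s n)) (nrm (f - s m)).
  move: (m.+1%:R^-1 : R) (n.+1%:R^-1 : R) (d) => y1 y2 y3 y4 y5 y6 *; lra.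
have [l ml hl] : exists2 l, mem l & hcvg H s l.
  apply: hcomplete => // e e0.
  have /cvgrPdist_lt harm := @cvg_harmonic R.
  have e4 : 0 < e ^+ 2 / 4 by rewrite divr_gt0// exprn_gt0.
  have [N _ hN] := harm _ e4.
  exists N => m n Nm Nn.
  rewrite -(@ltr_pXn2r _ 2)// ?nnegrE ?hnorm_ge0 ?(ltW e0)//.
  apply: le_lt_trans (mid m n) _.
  have := hN m Nm; have := hN n Nn; rewrite /harmonic /= !sub0r !normrN.
  rewrite !ger0_norm ?invr_ge0//; move: (m.+1%:R^-1 : R) (n.+1%:R^-1 : R) (e ^+ 2).
  by move=> *; lra.
(* The shift [g] will be [0] in one use and [c *: w] in the other. *)
have lim g : mem g -> nrm (f - (s n + g)) @[n --> \oo] --> nrm (f - (l + g)).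
  move=> hg; apply: hcvg_dist.
  - exact: memB (memD _ _).
  - by move=> n; exact: memB (memD _ _).
  - rewrite /hcvg (_ : (fun n => _) = (fun n => nrm (s n - l)))//.
    apply/funext => n; rewrite [RHS]hnorm_distC//; congr nrm.
    by apply/funext => x; rewrite !fctE /=; ring.
have lim2 g : mem g -> nrm (f - (s n + g)) ^+ 2 @[n --> \oo] --> nrm (f - (l + g)) ^+ 2.
  by move=> /lim h; apply: cvgM.
exists l, s => // w Ww; have mw := WH _ Ww.
apply: orthogonal_of_min => //; first exact: memB.
(* The infimum [d] separates the two sides: the squared distances from [f] to [s n] are below
   [d + 1 / (n + 1)], and [s n + c *: w] stays in [W]. *)
move=> c; apply: (@le_trans _ _ d).
  have := lim2 _ (mem0 H); rewrite addr0 => h.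
  have h' : d + n.+1%:R^-1 @[n --> \oo] --> d + 0.
    by apply: cvgD; [exact: cvg_cst|exact: cvg_harmonic].
  rewrite -[d]addr0; apply: (ler_cvg_to h h').
  by near=> n; rewrite addr0; apply: ltW (hs n).2.
have mcw := memZ c mw.
have := lim2 _ mcw; rewrite opprD addrA => h.
apply: (ler_cvg_to (cvg_cst d) h).
near=> n; apply: dW; rewrite addrC; exact: WL.
Unshelve. all: by end_near.
Qed.

End projection.

(** * Finite linear combinations of a family *)

Section combinations.
Context {R : realType} {T X : Type} {k : T -> T -> R[i]} (H : rkhs k).
Context (e : X -> T -> R[i]) (he : forall x, carrier H (e x)).

(** The list of coefficients and indices is kept as data, so that the same combination can be formed
    from a second family in another space. *)
Definition comb (s : seq (R[i] * X)) : T -> R[i] :=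
  \sum_(p <- s) p.1 *: e p.2.

Lemma mem_comb s : carrier H (comb s).
Proof.
rewrite /comb; elim: s => [|p s IH]; first by rewrite big_nil; exact: mem0.
by rewrite big_cons; exact: mem_lin.
Qed.

Lemma comb_lin c s s' :
  c *: comb s + comb s' = comb ([seq (c * p.1, p.2) | p <- s] ++ s').
Proof.
rewrite /comb big_cat big_map scaler_sumr; congr (_ + _).
by apply: eq_bigr => p _; rewrite scalerA.
Qed.

Lemma dot_combl s u : carrier H u ->
  dot H (comb s) u = \sum_(p <- s) p.1 * dot H (e p.2) u.
Proof.
move=> hu; rewrite /comb; elim: s => [|p s IH]; first by rewrite !big_nil dot0l.
by rewrite !big_cons dot_linl ?IH//; exact: mem_comb.
Qed.

Lemma dot_combr s u : carrier H u ->
  dot H u (comb s) = \sum_(p <- s) p.1^* * dot H u (e p.2).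
Proof.
move=> hu; rewrite dotC ?dot_combl//; last exact: mem_comb.
rewrite rmorph_sum/=; apply: eq_bigr => p _.
by rewrite rmorphM/= -dotC.
Qed.

Lemma combE s x : comb s x = \sum_(p <- s) p.1 * e p.2 x.
Proof. by rewrite /comb fct_sumE. Qed.

End combinations.

(** * Isometries between closed spans of families with equal Gram matrices *)

Section transfer.
Context {R : realType} {T1 T2 X : Type}.
Context {k1 : T1 -> T1 -> R[i]} (H1 : rkhs k1).
Context {k2 : T2 -> T2 -> R[i]} (H2 : rkhs k2).
Context (e1 : X -> T1 -> R[i]) (e2 : X -> T2 -> R[i]).
Hypothesis m1 : forall x, carrier H1 (e1 x).
Hypothesis m2 : forall x, carrier H2 (e2 x).
Hypothesis gram : forall x y, dot H1 (e1 x) (e1 y) = dot H2 (e2 x) (e2 y).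

(** Both norms depend only on the coefficients and on the common Gram matrix. *)
Lemma comb_isometry s : hnorm H1 (comb e1 s) = hnorm H2 (comb e2 s).
Proof.
rewrite /hnorm /dot_norm !dot_combl//; [|exact: mem_comb..].
do 2!congr (_ _); apply: eq_bigr => p _; congr (_ * _).
by rewrite !dot_combr//; apply: eq_bigr => q _; rewrite gram.
Qed.

Lemma combB s s' (T : Type) (e : X -> T -> R[i]) :
  comb e s - comb e s' = comb e ([seq (-1 * p.1, p.2) | p <- s'] ++ s).
Proof. by rewrite -comb_lin scaleN1r addrC. Qed.

(* The orthogonal projection [l] of [f] to the closed span of the [e1 x] is
   carried to [t] by the isometry [e1 x |-> e2 x] of closed spans. *)
Lemma transfer f : carrier H1 f -> exists l t,
  (exists2 c : nat -> seq (R[i] * X),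
     hcvg H1 (comb e1 \o c) l & hcvg H2 (comb e2 \o c) t) /\
  [/\ carrier H1 l, carrier H2 t, hnorm H2 t <= hnorm H1 f,
      (forall x, dot H1 (f - l) (e1 x) = 0) &
      (forall x, dot H2 t (e2 x) = dot H1 f (e1 x))].
Proof.
move=> hf; pose W := range (comb e1).
have [l [s [ml Ws sl] orth]] : exists l, exists2 s,
    [/\ carrier H1 l, (forall n, W (s n)) & hcvg H1 s l] &
    forall w, W w -> dot H1 (f - l) w = 0.
  apply: projection => //.
  - by move=> _ [c _ <-]; exact: mem_comb.
  - by exists [::] => //; rewrite /comb big_nil.
  - by move=> c _ _ [a _ <-] [b _ <-]; rewrite comb_lin; eexists.
have /choice[c hc] : forall n, exists c, comb e1 c = s n.
  by move=> n; have [c _ h] := Ws n; exists c.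
have mc1 n := mem_comb m1 (c n); have mc2 n := mem_comb m2 (c n).
have {}sl : hcvg H1 (comb e1 \o c) l.
  by rewrite (_ : _ \o _ = s)//; apply/funext => n /=.
(* By [comb_isometry], the combinations of [e2] with the same coefficients form a Cauchy sequence
   too. *)
have [t mt tl] : exists2 t, carrier H2 t & hcvg H2 (comb e2 \o c) t.
  apply: hcomplete => // r r0.
  have [N hN] := hcvg_cauchy ml mc1 sl r0; exists N => m n Nm Nn.
  by have := hN _ _ Nm Nn; rewrite /= !combB comb_isometry.
have orthe x : dot H1 (f - l) (e1 x) = 0.
  apply: orth; exists [:: (1, x)] => //.
  by rewrite /comb big_seq1 scale1r.
exists l, t; split; [by exists c|split => //].
(* The norms of [t] and [l] agree as limits of equal norms. As [f - l] is orthogonal to [l],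
   Cauchy-Schwarz for [dot H1 f l] then bounds the norm of [l] by that of [f]. *)
- have -> : hnorm H2 t = hnorm H1 l.
    apply: (cvg_unique _ (hcvg_dist mt mc2 tl)) => //.
    have := hcvg_dist ml mc1 sl.
    by under eq_cvg do rewrite /= comb_isometry.
  have hfl := memB hf ml.
  have fll : dot H1 (f - l) l = 0.
    rewrite dotC// (_ : dot H1 l _ = 0) ?conjc0//.
    apply: (ccvg_unique (hcvg_dot ml mc1 hfl sl)).
    apply: (@eq_ccvg _ _ _ (fun=> 0) _ 0); last exact: ccvg_cst.
    move=> n /=.
    rewrite dotC// dot_combr// big1 ?conjc0// => p _.
    by rewrite orthe mulr0.
  have h : dot H1 f l = dot H1 l l by apply/eqP; rewrite -subr_eq0 -dotBl// fll.
  have := cauchy_schwarz hf ml; rewrite h dot_hnorm//.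
  rewrite ger0_norm ?ler0c ?sqr_ge0// lecR expr2 => h2.
  have [->|l0] := eqVneq (hnorm H1 l) 0; first by rewrite hnorm_ge0.
  move: h2; rewrite ler_pM2r//.
  by rewrite lt_neqAle eq_sym l0 hnorm_ge0.
- move=> x.
  have -> : dot H1 f (e1 x) = dot H1 l (e1 x).
    by apply/eqP; rewrite -subr_eq0 -dotBl// orthe.
  apply: (ccvg_unique (hcvg_dot mt mc2 (m2 x) tl)).
  apply: eq_ccvg (hcvg_dot ml mc1 (m1 x) sl) => n /=.
  by rewrite !dot_combl//; apply: eq_bigr => p _; rewrite gram.
Qed.

End transfer.

(** * The space l2 over an arbitrary index type *)

#[local] Existing Instance totally_filter.

(** * Unconditional sums along finite sets *)

Section sums.
Context {R : realType} {T : choiceType}.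
Implicit Types (A B : {fset T}) (s : seq T).

Lemma near_totally (A0 : {fset T}) (P : {fset T} -> Prop) :
  (forall A, (A0 `<=` A)%fset -> P A) -> \forall A \near totally, P A.
Proof. by move=> h; exists A0. Qed.

Lemma totallyP (P : {fset T} -> Prop) :
  (\forall A \near totally, P A) -> exists A0, forall A, (A0 `<=` A)%fset -> P A.
Proof. by move=> [A0 _ h]; exists A0. Qed.

Definition fset_of s : {fset T} := [fset x in s]%fset.

Lemma mem_fset_of s x : (x \in fset_of s) = (x \in s).
Proof. by rewrite inE. Qed.

Lemma big_fset_of (V : nmodType) s (F : T -> V) : uniq s ->
  \sum_(x <- fset_of s) F x = \sum_(x <- s) F x.
Proof.
move=> us; apply: perm_big; apply: uniq_perm => // x.
exact: mem_fset_of.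
Qed.

Lemma ler_sum_subset (F : T -> R) s s' : (forall x, 0 <= F x) -> uniq s -> uniq s' ->
  {subset s <= s'} -> \sum_(x <- s) F x <= \sum_(x <- s') F x.
Proof.
move=> F0 us us' ss'; rewrite [leRHS](bigID (mem s))/=.
have -> : \sum_(x <- s) F x = \sum_(x <- s' | mem s x) F x.
  rewrite -[RHS]big_filter; apply: perm_big; apply: uniq_perm => // [|x].
    exact: filter_uniq.
  by rewrite mem_filter andb_idr//; exact: ss'.
by rewrite lerDl sumr_ge0.
Qed.

Lemma cvg_totally_nondecreasing (F : T -> R) (M : R) : (forall x, 0 <= F x) ->
  (forall A, \sum_(x <- A) F x <= M) ->
  exists2 N : R, (fun A => \sum_(x <- A) F x) @ totally --> N &
    N <= M /\ forall A, \sum_(x <- A) F x <= N.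
Proof.
move=> F0 hM; pose S := range (fun A : {fset T} => \sum_(x <- A) F x).
have S0 : S !=set0 by exists (\sum_(x <- fset0) F x); exists fset0.
have uS : ubound S M by move=> _ [A _ <-].
have hS : has_sup S by split => //; exists M.
have leS A : \sum_(x <- A) F x <= sup S by apply: ub_le_sup; [exists M|exists A].
exists (sup S); last by split => //; exact: ge_sup.
apply/cvgrPdist_lt => e e0; have [_ [A _ <-] hA] := sup_adherent e0 hS.
apply: (@near_totally A) => B /fsubsetP AB; rewrite ger0_norm ?subr_ge0//.
have := ler_sum_subset F0 (fset_uniq A) (fset_uniq B) AB.
by move: hA (leS B); move: (\sum_(x <- A) F x) (\sum_(x <- B) F x) (sup S) => *; lra.
Qed.

(** An unconditional sum may be computed along any sequence of finite lists that eventually contain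
    each finite set. *)
Lemma ccvg_cofinal (h : T -> R[i]) (a : R[i]) (s : nat -> seq T) :
  (forall n, uniq (s n)) ->
  (forall A, exists N, forall n, (N <= n)%N -> {subset A <= s n}) ->
  ccvg totally (fun A => \sum_(x <- A) h x) a ->
  ccvg \oo (fun n => \sum_(x <- s n) h x) a.
Proof.
move=> us cof /ccvgP ha; apply/ccvgP => e /ha/totallyP[A hA].
have [N hN] := cof A; exists N => // n /hN Asn.
rewrite -big_fset_of//; apply: hA; apply/fsubsetP => x /Asn.
by rewrite mem_fset_of.
Qed.

End sums.

Lemma ccvg_sum {R : realType} {I : Type} {F : set_system I} {FF : ProperFilter F}
    {J : Type} (s : seq J) (u : J -> I -> R[i]) (a : J -> R[i]) :
  (forall j, ccvg F (u j) (a j)) ->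
  ccvg F (fun n => \sum_(j <- s) u j n) (\sum_(j <- s) a j).
Proof.
move=> h; elim: s => [|j s IH].
  rewrite big_nil; apply: (@eq_ccvg _ _ F (fun=> 0)); last exact: ccvg_cst.
  by move=> n; rewrite big_nil.
by rewrite big_cons; apply: eq_ccvg (ccvgD (h j) IH) => n; rewrite big_cons.
Qed.

(** * Inner product and completeness of l2 *)

Section l2.
Context {R : realType} {T : choiceType}.
Implicit Types (f g : T -> R[i]) (A B : {fset T}) (c : R[i]).

Definition nsq (z : R[i]) : R := complex.Re z ^+ 2 + complex.Im z ^+ 2.

Lemma nsq_ge0 z : 0 <= nsq z.
Proof. by rewrite addr_ge0 ?sqr_ge0. Qed.

Lemma nsqE z : (nsq z)%:C = z * z^*.
Proof. by rewrite -sqr_normc -add_Re2_Im2. Qed.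

Lemma nsq0 z : nsq z = 0 -> z = 0.
Proof.
move=> h; apply/eqP; have := nsqE z; rewrite h => /esym/eqP.
by rewrite mulf_eq0 conjc_eq0 orbb.
Qed.

(** The right side exceeds the left by the squared modulus of [c * x - y]. *)
Lemma nsq_lin c x y : nsq (c * x + y) <= 2 * nsq c * nsq x + 2 * nsq y.
Proof.
case: c x y => [c c'] [x x'] [y y']; rewrite /nsq /=.
rewrite -subr_ge0; have := sqr_ge0 (c * x - c' * x' - y).
by have := sqr_ge0 (c * x' + c' * x - y'); nra.
Qed.

Definition l2 : set (T -> R[i]) :=
  [set f | exists M, forall A, \sum_(x <- A) nsq (f x) <= M].

(* The junk value [0] is never taken on [l2]; see [l2dot_cvg]. *)
Definition l2dot f g : R[i] :=
  xget 0 [set a | ccvg totally (fun A => \sum_(x <- A) f x * (g x)^*) a].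

Lemma l2dotE f g a : ccvg totally (fun A => \sum_(x <- A) f x * (g x)^*) a ->
  l2dot f g = a.
Proof. by move=> h; apply: (ccvg_unique _ h); apply: (xgetPex 0); exists a. Qed.

Lemma l2_lin c f g : l2 f -> l2 g -> l2 (fun x => c * f x + g x).
Proof.
move=> [M hM] [N hN]; exists (2 * nsq c * M + 2 * N) => A.
apply: (@le_trans _ _ (2 * nsq c * (\sum_(x <- A) nsq (f x)) + 2 * (\sum_(x <- A) nsq (g x)))).
  by rewrite !mulr_sumr -big_split ler_sum// => x _; exact: nsq_lin.
by rewrite lerD// ler_wpM2l// mulr_ge0// nsq_ge0.
Qed.

Lemma l20 : l2 (fun=> 0).
Proof. by exists 0 => A; rewrite big1// => x _; rewrite /nsq /= expr0n addr0. Qed.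

(** The limit is the supremum of the finite sums; the equivalence exchanges bounds on all finite
    sums for bounds on the norm. *)
Lemma l2_sqr f : l2 f -> exists2 N : R,
  ccvg totally (fun A => \sum_(x <- A) f x * (f x)^*) N%:C &
  forall M, (forall A, \sum_(x <- A) nsq (f x) <= M) <-> N <= M.
Proof.
move=> [M hM]; have [N hN [NM leN]] := cvg_totally_nondecreasing (fun x => nsq_ge0 (f x)) hM.
exists N.
  apply: eq_ccvg (ccvg_real hN) => A.
  by rewrite rmorph_sum; apply: eq_bigr => x _; exact: nsqE.
move=> M'; split=> [hM'|h A]; last exact: le_trans (leN A) h.
have [N' hN' [NM' _]] := cvg_totally_nondecreasing (fun x => nsq_ge0 (f x)) hM'.
by rewrite (cvg_unique _ hN hN').
Qed.

Lemma l2dot_cvg f g : l2 f -> l2 g ->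
  ccvg totally (fun A => \sum_(x <- A) f x * (g x)^*) (l2dot f g).
Proof.
move=> hf hg; suff [a ha] : exists a,
    ccvg totally (fun A => \sum_(x <- A) f x * (g x)^*) a by rewrite (l2dotE ha).
(* By polarization it suffices to sum squares. *)
have ex c : exists a, ccvg totally
    (fun A => \sum_(x <- A) (c * g x + f x) * (c * g x + f x)^*) a.
  by have [N hN _] := l2_sqr (l2_lin c hg hf); exists N%:C.
have [[a ha] [b hb]] := (ex 1, ex (-1)).
have [[c hc] [d hd]] := (ex ('i%C : R[i]), ex (- 'i%C : R[i])).
have q4 : ccvg (@totally T) (fun=> 4^-1 : R[i]) 4^-1 by exact: ccvg_cst.
have ii : ccvg (@totally T) (fun=> 'i%C : R[i]) 'i%C by exact: ccvg_cst.
exists (4^-1 * ((a - b) + 'i%C * (c - d))).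
apply: eq_ccvg (ccvgM q4 (ccvgD (ccvgB ha hb) (ccvgM ii (ccvgB hc hd)))) => A.
rewrite -!sumrB [in X in _ + X]mulr_sumr -big_split mulr_sumr/=.
apply: eq_bigr => x _; case: (f x) (g x) => [p q] [r s].
have n4 : 4 != 0 :> R[i] by [].
apply: (mulfI n4); rewrite mulrA divff// mul1r.
by apply/eqP; rewrite eq_complex /=; apply/andP; split; apply/eqP; ring.
Qed.

Lemma nsq_le_l2dot f x : l2 f -> nsq (f x) <= complex.Re (l2dot f f).
Proof.
move=> hf; have [N hN hM] := l2_sqr hf; rewrite (l2dotE hN)/=.
have := (hM N).2 (lexx _) [fset x]%fset.
by rewrite big_seq_fset1.
Qed.

Lemma l2dotDZ c f g u : l2 f -> l2 g -> l2 u ->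
  l2dot (fun x => c * f x + g x) u = c * l2dot f u + l2dot g u.
Proof.
move=> hf hg hu; apply: l2dotE.
have hc : ccvg (@totally T) (fun=> c) c by exact: ccvg_cst.
apply: eq_ccvg (ccvgD (ccvgM hc (l2dot_cvg hf hu)) (l2dot_cvg hg hu)) => A.
by rewrite mulr_sumr -big_split; apply: eq_bigr => x _ /=; ring.
Qed.

Lemma l2dotC f g : l2 f -> l2 g -> l2dot f g = (l2dot g f)^*.
Proof.
move=> hf hg; apply: l2dotE; apply: eq_ccvg (ccvgJ (l2dot_cvg hg hf)) => A.
rewrite rmorph_sum; apply: eq_bigr => x _ /=.
by rewrite rmorphM/= conjcK mulrC.
Qed.

Lemma l2dot_ge0 f : l2 f -> 0 <= l2dot f f.
Proof.
move=> hf; have [N hN hM] := l2_sqr hf; rewrite (l2dotE hN) ler0c.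
by have := (hM N).2 (lexx _) fset0; rewrite big_seq_fset0.
Qed.

Lemma l2dot_eq0 f : l2 f -> l2dot f f = 0 -> f = (fun=> 0).
Proof.
move=> hf h; apply/funext => x; apply: nsq0; apply/eqP; rewrite eq_le nsq_ge0 andbT.
by have := nsq_le_l2dot x hf; rewrite h.
Qed.

Lemma l2_delta w : l2 (fun z => (z == w)%:R).
Proof.
exists 1 => A; have [wA|wA] := boolP (w \in A).
  rewrite (big_fsetD1 w)//= eqxx big1_fset ?addr0 => [|x].
    by rewrite /nsq /= expr1n expr0n addr0.
  by rewrite !inE => /andP[/negPf -> _] _; rewrite /nsq /= expr0n addr0.
rewrite big1_fset// => x xA _; have /negPf -> : x != w by apply: contra wA => /eqP <-.
by rewrite /nsq /= expr0n addr0.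
Qed.

Lemma l2dot_delta f w : l2 f -> l2dot f (fun z => (z == w)%:R) = f w.
Proof.
move=> hf; apply: l2dotE; apply/ccvgP => e e0; apply: (@near_totally _ [fset w]%fset) => A.
rewrite fsub1set => wA; rewrite (big_fsetD1 w)//= eqxx conjc1 mulr1 big1_fset.
  by rewrite addr0 subrr normr0 ltcR.
by move=> x; rewrite !inE => /andP[/negPf -> _] _; rewrite conjc0 mulr0.
Qed.

(** The limit is taken point by point, and the Cauchy bounds on finite sums survive the passage to
    the limit. *)
Lemma l2_complete (u : nat -> T -> R[i]) : (forall n, l2 (u n)) ->
  (forall e : R, 0 < e -> exists N : nat, forall m n : nat,
    (N <= m)%N -> (N <= n)%N -> dot_norm l2dot (fun x => u m x - u n x) < e) ->
  exists2 l, l2 l & dot_norm l2dot (fun x => u n x - l x) @[n --> \oo] --> (0 : R).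
Proof.
move=> hu cauchy.
have hB m n : l2 (fun x => u m x - u n x).
  have -> : (fun x => u m x - u n x) = (fun x => -1 * u n x + u m x).
    by apply/funext => x; rewrite mulN1r addrC.
  exact: l2_lin.
have sqB m n : complex.Re (l2dot (fun x => u m x - u n x) (fun x => u m x - u n x)) =
    dot_norm l2dot (fun x => u m x - u n x) ^+ 2.
  rewrite sqr_sqrtr//; have := l2dot_ge0 (hB m n).
  by rewrite lecE => /andP[].
have {}cauchy (e : R) : 0 < e -> exists N : nat, forall m n : nat,
    (N <= m)%N -> (N <= n)%N -> forall A, \sum_(x <- A) nsq (u m x - u n x) <= e ^+ 2.
  move=> /cauchy[N hN]; exists N => m n Nm Nn.
  have [M hM leM] := l2_sqr (hB m n); apply/leM.
  have := sqB m n; rewrite (l2dotE hM)/= => ->.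
  rewrite ler_pXn2r ?nnegrE ?sqrtr_ge0 ?ltW ?hN//.
  by apply: le_lt_trans (hN m n Nm Nn); exact: sqrtr_ge0.
have pw x : exists a, ccvg \oo (fun n => u n x) a.
  (* Real and imaginary parts are treated at once, as maps [p] that respect differences and whose
     square is at most [nsq]. *)
  have pc (p : R[i] -> R) : (forall a b, p (a - b) = p a - p b) ->
      (forall a, p a ^+ 2 <= nsq a) -> exists a : R, p (u n x) @[n --> \oo] --> a.
    move=> pB ple; suff /cvg_ex[a ha] : cvgn (fun n => p (u n x)) by exists a.
    apply/cauchy_cvgP/cauchy_exP => e e0.
    have [N hN] := cauchy (e / 2) (divr_gt0 e0 (ltr0n R 2)).
    exists (p (u N x)); exists N => // n Nn.
    change (`|p (u N x) - p (u n x)| < e).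
    have := hN N n (leqnn N) Nn [fset x]%fset; rewrite big_seq_fset1.
    move=> /(le_trans (ple _)); rewrite pB -[leLHS]real_normK ?num_real//.
    rewrite ler_pXn2r ?nnegrE ?divr_ge0 ?(ltW e0)//.
    by move=> h; apply: (le_lt_trans h); rewrite ltr_pdivrMr// ltr_pMr// ltr1n.
  have [||a ha] := pc (@complex.Re R); [by case=> ? ? [? ?]| |].
    by move=> a; rewrite /nsq lerDl sqr_ge0.
  have [||b hb] := pc (@complex.Im R); [by case=> ? ? [? ?]| |].
    by move=> b; rewrite /nsq lerDr sqr_ge0.
  by exists (a +i* b); apply: ccvg_ReIm.
have /choice[l hl] := pw.
(* For a fixed finite set [A], let [m] tend to infinity in the Cauchy bound; the rank [N] is the
   same for all [A]. *)
have tail (e : R) : 0 < e -> exists N : nat, forall n : nat, (N <= n)%N ->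
    forall A, \sum_(x <- A) nsq (u n x - l x) <= e ^+ 2.
  move=> /cauchy[N hN]; exists N => n Nn A.
  have lim : ccvg \oo (fun m => \sum_(x <- A) (u n x - u m x) * (u n x - u m x)^*)
      (\sum_(x <- A) (u n x - l x) * (u n x - l x)^*).
    apply: ccvg_sum => x; have h : ccvg \oo (fun m => u n x - u m x) (u n x - l x).
      exact: (ccvgB (ccvg_cst _) (hl x)).
    exact: (ccvgM h (ccvgJ h)).
  have sumE v : complex.Re (\sum_(x <- A) (u n x - v x) * (u n x - v x)^*) =
      \sum_(x <- A) nsq (u n x - v x).
    by rewrite raddf_sum/=; apply: eq_bigr => x _; rewrite -nsqE.
  have limR : \sum_(x <- A) nsq (u n x - u m x) @[m --> \oo] -->
      \sum_(x <- A) nsq (u n x - l x).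
    by rewrite -sumE; under eq_cvg do rewrite -sumE; exact: ccvg_Re lim.
  have limC : (fun=> e ^+ 2) @ \oo --> e ^+ 2 by exact: cvg_cst.
  apply: (ler_cvg_to limR limC); near=> m; apply: hN => //.
  by near: m; exists N.
have lim_mem n : l2 (fun x => u n x - l x) -> l2 l.
  move=> h; have -> : l = (fun x => -1 * (u n x - l x) + u n x).
    by apply/funext => x; rewrite mulN1r opprB subrK.
  exact: l2_lin.
have [N hN] := tail 1 ltr01.
exists l; first by apply: (@lim_mem N); exists (1 ^+ 2) => A; exact: hN.
apply/cvgrPdist_le => e e0; have [M hM] := tail e e0; exists M => // n /hM/= {}hM.
rewrite sub0r normrN ger0_norm ?sqrtr_ge0//.
have hn : l2 (fun x => u n x - l x) by exists (e ^+ 2).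
have [K hK leK] := l2_sqr hn; rewrite /dot_norm (l2dotE hK)/=.
by rewrite -[leRHS](ger0_norm (ltW e0)) -sqrtr_sqr ler_wsqrtr//; apply/leK.
Unshelve. all: by end_near.
Qed.

(** For the Kronecker delta, the reproducing property says that inner products with unit vectors are
    coordinates. Thus l2 is an [rkhs], and projection and transfer apply to it. *)
Definition l2_kernel (x y : T) : R[i] := (x == y)%:R.

Definition l2_rkhs : rkhs l2_kernel :=
  RKHS l20 l2_lin l2dotDZ l2dotC l2dot_ge0 l2dot_eq0 l2_complete l2_delta
    (fun f w hf => l2dot_delta w hf).

End l2.

(** * Shifts on words *)

Section reindexing.
Context {R : realType} {T T' : choiceType}.
Context (phi : T -> T') (psi : T' -> option T).
Hypothesis phiK : forall x, psi (phi x) = Some x.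
Hypothesis psiK : forall y x, psi y = Some x -> phi x = y.
Implicit Types (f : T -> R[i]) (g : T' -> R[i]).

(* Extension by zero along the injection [phi]. *)
Definition push f : T' -> R[i] := fun y => oapp f 0 (psi y).

Lemma sum_oapp (V : nmodType) (F : T -> V) (s : seq T') :
  \sum_(y <- s) oapp F 0 (psi y) = \sum_(x <- pmap psi s) F x.
Proof.
elim: s => [|y s IH]; first by rewrite !big_nil.
rewrite big_cons IH /=; case: (psi y) => [x|] /=; first by rewrite big_cons.
by rewrite add0r.
Qed.

Lemma uniq_pmap_psi (s : seq T') : uniq s -> uniq (pmap psi s).
Proof.
apply: (@pmap_uniq _ _ psi phi) => y.
by case E: (psi y) => [x|] //=; exact: psiK.
Qed.

Lemma l2_pull g : l2 g -> l2 (g \o phi).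
Proof.
move=> [M hM]; exists M => A; have := hM (fset_of (map phi A)).
rewrite big_fset_of ?big_map// map_inj_uniq//.
by move=> x y /(congr1 psi); rewrite !phiK => -[].
Qed.

Lemma l2_push f : l2 f -> l2 (push f).
Proof.
move=> [M hM]; exists M => B.
rewrite (eq_bigr (fun y => oapp (fun x => nsq (f x)) 0 (psi y))) => [|y _]; last first.
  by rewrite /push; case: (psi y) => //=; rewrite /nsq /= expr0n addr0.
by rewrite sum_oapp -big_fset_of ?uniq_pmap_psi.
Qed.

(** Terms outside the image of [phi] vanish, so the adjoint of extension by zero is restriction
    along [phi]. *)
Lemma l2dot_push f g : l2 f -> l2 g -> l2dot (push f) g = l2dot f (g \o phi).
Proof.
move=> hf hg; apply: l2dotE; apply/ccvgP => e e0.
have /ccvgP/(_ _ e0)/totallyP[A hA] := l2dot_cvg hf (l2_pull hg).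
apply: (@near_totally _ (fset_of (map phi A))) => B /fsubsetP AB.
rewrite (eq_bigr (fun y => oapp (fun x => f x * (g (phi x))^*) 0 (psi y))) => [|y _].
  rewrite sum_oapp -big_fset_of ?uniq_pmap_psi//; apply: hA.
  apply/fsubsetP => x xA; rewrite mem_fset_of mem_pmap -phiK map_f// AB//.
  by rewrite mem_fset_of map_f.
by rewrite /push; case E: (psi y) => [x|] /=; rewrite ?mul0r// (psiK E).
Qed.

End reindexing.

(** The partial inverse of prepending [a], in the form that [push] takes. *)
Fixpoint strip (a w : seq nat) : option (seq nat) :=
  match a, w with
  | [::], _ => Some w
  | i :: a', j :: w' => if i == j then strip a' w' else None
  | _, [::] => None
  end.

Lemma strip_cat a w : strip a (a ++ w) = Some w.
Proof. by elim: a => //= i a IH; rewrite eqxx. Qed.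

Lemma cat_strip a w v : strip a w = Some v -> a ++ v = w.
Proof.
elim: a w => [|i a IH] [|j w] //=; try by move=> [].
by case: eqP => // -> /IH ->.
Qed.

(** * Left shifts, monomials and finite lists of words *)

Section words.
Context {R : realType}.

(** The left creation operator [L_a]: it moves the coefficient of [w] to [a ++ w]. *)
Definition wshift (a : seq nat) (u : seq nat -> R[i]) : seq nat -> R[i] :=
  push (strip a) u.

Lemma wshift_nil u : wshift [::] u = u.
Proof. by apply/funext => w. Qed.

Lemma wshift_cons i a u j w :
  wshift (i :: a) u (j :: w) = if i == j then wshift a u w else 0.
Proof. by rewrite /wshift /push /=; case: eqP. Qed.

Lemma wshift_cons_nil i a u : wshift (i :: a) u [::] = 0.
Proof. by []. Qed.

Lemma l2_wshift a u : l2 u -> l2 (wshift a u).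
Proof. exact: (l2_push (@cat_strip a)). Qed.

Lemma l2dot_wshift a u v : l2 u -> l2 v ->
  l2dot (wshift a u) v = l2dot u (v \o cat a).
Proof. exact: (l2dot_push (@strip_cat a) (@cat_strip a)). Qed.

Definition mono {K : comNzRingType} (z : nat -> K) (w : seq nat) : K :=
  \prod_(i <- w) z i.

Lemma mono_cat (K : comNzRingType) (z : nat -> K) a b :
  mono z (a ++ b) = mono z a * mono z b.
Proof. exact: big_cat. Qed.

Lemma monoM (K : comNzRingType) (y z : nat -> K) a :
  mono y a * mono z a = mono (fun i => y i * z i) a.
Proof. by rewrite /mono -big_split. Qed.

Lemma monoJ (z : nat -> R[i]) a : (mono z a)^* = mono (fun i => (z i)^*) a.
Proof. by rewrite /mono rmorph_prod. Qed.

Fixpoint words (m n : nat) : seq (seq nat) :=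
  if n is n'.+1 then [seq i :: w | i <- iota 0 m, w <- words m n'] else [:: [::]].

(** Expanding the power chooses one letter from each factor. *)
Lemma sum_words (K : comNzRingType) (z : nat -> K) m n :
  \sum_(w <- words m n) mono z w = (\sum_(0 <= i < m) z i) ^+ n.
Proof.
elim: n => [|n IH] /=; first by rewrite big_seq1 /mono big_nil expr0.
rewrite big_allpairs_dep exprS -IH mulr_suml /index_iota subn0; apply: eq_bigr => i _.
rewrite mulr_sumr; apply: eq_bigr => w _.
by rewrite /mono big_cons.
Qed.

Lemma mem_words m n w : (w \in words m n) = (size w == n) && all (ltn^~ m) w.
Proof.
elim: n w => [|n IH] w /=; first by rewrite inE size_eq0; case: w.
apply/allpairsP/idP => [[[i v] /= [+ + ->]]|].
  by rewrite mem_iota IH /= add0n eqSS => -> ->.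
case: w => [|i v] //=; rewrite eqSS => /and3P[sv im av].
by exists (i, v); rewrite mem_iota IH sv av.
Qed.

Lemma uniq_words m n : uniq (words m n).
Proof.
elim: n => [|n IH] //=; apply: allpairs_uniq => //; first exact: iota_uniq.
by move=> [i v] [j w] _ _ /= [-> ->].
Qed.

(** One bound limits both the length and the letters, so each list is finite although the alphabet
    is infinite. *)
Definition wordlist N : seq (seq nat) := flatten [seq words N n | n <- iota 0 N].

Lemma mem_wordlist N w : (w \in wordlist N) = (size w < N)%N && all (ltn^~ N) w.
Proof.
apply/flatten_mapP/idP => [[n]|/andP[sw aw]].
  by rewrite mem_iota mem_words add0n => /= ltn /andP[/eqP -> ->]; rewrite ltn.
by exists (size w); rewrite ?mem_iota ?mem_words ?eqxx.
Qed.

Lemma uniq_wordlist N : uniq (wordlist N).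
Proof.
rewrite /wordlist; elim: (iota 0 N) (iota_uniq 0 N) => [|n s IH] //= /andP[ns us].
rewrite cat_uniq uniq_words IH// andbT; apply/hasPn => w /flatten_mapP[k ks].
rewrite mem_words => /andP[/eqP sw _]; apply: contra ns => /=.
by rewrite mem_words sw => /andP[/eqP <-].
Qed.

Lemma wordlist_cofinal (A : seq (seq nat)) :
  exists N, forall n, (N <= n)%N -> {subset A <= wordlist n}.
Proof.
elim: A => [|w A [N hN]]; first by exists 0%N.
exists (maxn N (maxn (size w).+1 (foldr maxn 0%N (map succn w)))) => n.
rewrite !geq_max => /and3P[Nn sw aw] v; rewrite inE => /predU1P[->|]; last exact: hN.
rewrite mem_wordlist sw /=; elim: w aw {sw} => //= i w IH.
by rewrite geq_max => /andP[-> /IH].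
Qed.

(** The words of length [n] contribute the [n]-th power, which leaves a finite geometric sum. *)
Lemma sum_wordlist (K : comNzRingType) (z : nat -> K) N :
  (\sum_(0 <= i < N) z i - 1) * \sum_(w <- wordlist N) mono z w =
  (\sum_(0 <= i < N) z i) ^+ N - 1.
Proof.
rewrite subrX1 /wordlist big_flatten big_map; congr (_ * _).
rewrite -(big_mkord xpredT (fun i => _ ^+ i)) /index_iota subn0.
by apply: eq_bigr => i _; rewrite sum_words /index_iota subn0.
Qed.

End words.

Lemma normc_def_Re (R : realType) (x : R[i]) : `|x| = (complex.Re `|x|)%:C.
Proof. by rewrite normc_def. Qed.

(** * Point evaluations on the Fock space *)

Section ball.
Context {R : realType}.
Implicit Types (z w u v : nat -> R[i]).

Lemma iota_cofinal (A : seq nat) :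
  exists N, forall n, (N <= n)%N -> {subset A <= index_iota 0 n}.
Proof.
elim: A => [|i A [N hN]]; first by exists 0%N.
exists (maxn N i.+1) => n; rewrite geq_max => /andP[Nn iltn] j.
by rewrite inE => /predU1P[->|/hN->//]; rewrite mem_index_iota.
Qed.

(** A point of a finite-dimensional ball, extended by zero, lies in the ball of l2, so one Fock
    space over the alphabet of all naturals serves every [d]. *)
Definition ballr z : Prop :=
  exists2 s : R, s < 1 & forall n, \sum_(0 <= j < n) nsq (z j) <= s.

Lemma ball_setP (d : option nat) z : ball_set d z -> ballr z.
Proof.
move=> [_]; set S := (X in (X < _)%E) => h.
have ge n : ((\sum_(0 <= j < n) nsq (z j))%:E <= S)%E.
  by rewrite -sumEFin; apply: nneseries_lim_ge => i _ _; rewrite lee_fin nsq_ge0.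
have := ge 0%N; rewrite big_geq//; move: h ge; case: S => [s| |]//.
by rewrite lte_fin => s1 ge _; exists s => // n; rewrite -lee_fin.
Qed.

Lemma ballr_sum z : ballr z ->
  exists2 s : R, s < 1 & forall A : {fset nat}, \sum_(j <- A) nsq (z j) <= s.
Proof.
move=> [s s1 hs]; exists s => // A; have [N /(_ N (leqnn N)) hN] := iota_cofinal A.
apply: le_trans (hs N); apply: ler_sum_subset => //; last exact: iota_uniq.
by move=> x; exact: nsq_ge0.
Qed.

Lemma ballr_l2 z : ballr z -> l2 z.
Proof. by move=> /ballr_sum[s _ hs]; exists s. Qed.

Lemma ballr_hnorm z : ballr z -> hnorm (@l2_rkhs R nat) z < 1.
Proof.
move=> hz; have [s s1 hs] := ballr_sum hz; have lz := ballr_l2 hz.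
rewrite -(@ltr_pXn2r _ 2)// ?nnegrE ?hnorm_ge0// expr1n.
rewrite (@hnorm_Re _ _ _ (@l2_rkhs R nat))//=.
have [N hN /(_ s)[+ _]] := l2_sqr lz.
by rewrite (l2dotE hN) => /(_ hs) /= h; exact: le_lt_trans h s1.
Qed.

Lemma ballr_pairing z w : ballr z -> ballr w -> `|l2dot z w| < 1.
Proof.
move=> hz hw; have := cauchy_schwarz (H := @l2_rkhs R nat) (ballr_l2 hz) (ballr_l2 hw).
move=> /le_lt_trans; apply; rewrite ltcR.
by rewrite -[ltRHS]mulr1 ltr_pM ?hnorm_ge0 ?ballr_hnorm.
Qed.

Lemma pairing_cvg z w : ballr z -> ballr w ->
  ccvg \oo (fun n => \sum_(0 <= j < n) z j * (w j)^*) (l2dot z w).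
Proof.
move=> hz hw.
apply: (ccvg_cofinal (fun n => iota_uniq _ _) _ (l2dot_cvg (ballr_l2 hz) (ballr_l2 hw))).
exact: iota_cofinal.
Qed.

Lemma pairingE z w : ballr z -> ballr w -> pairing z w = l2dot z w.
Proof.
move=> hz hw; rewrite /pairing.
have h := pairing_cvg hz hw.
exact: (@cvg_lim R[i]^o _ nat \oo _ _ _ h).
Qed.

(* The Riesz representer in the Fock space of evaluation at [z]. *)
Definition kz z (a : seq nat) : R[i] := (mono z a)^*.

Lemma nsqM (x y : R[i]) : nsq (x * y) = nsq x * nsq y.
Proof. by case: x y => [a b] [c e]; rewrite /nsq /=; ring. Qed.

Lemma nsq_kz z a : nsq (kz z a) = mono (nsq \o z) a.
Proof.
have -> : nsq (kz z a) = nsq (mono z a).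
  by rewrite /kz; case: (mono z a) => x y; rewrite /nsq /= sqrrN.
rewrite /mono; elim: a => [|i a IH].
  by rewrite !big_nil /nsq /= expr1n expr0n addr0.
by rewrite !big_cons nsqM IH.
Qed.

Lemma l2_kz z : ballr z -> l2 (kz z).
Proof.
move=> [s s1 hs]; exists (1 - s)^-1 => A.
have [N /(_ N (leqnn N)) hN] := wordlist_cofinal A.
apply: (@le_trans _ _ (\sum_(a <- wordlist N) nsq (kz z a))).
  apply: ler_sum_subset => //; last exact: uniq_wordlist.
  by move=> x; exact: nsq_ge0.
under eq_bigr do rewrite nsq_kz.
have := sum_wordlist (nsq \o z) N; set X := \sum_(a <- wordlist N) _.
have X0 : 0 <= X by apply: sumr_ge0 => a _; move: (nsq_ge0 (kz z a)); rewrite nsq_kz.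
have := hs N; have : 0 <= \sum_(0 <= i < N) (nsq \o z) i.
  by apply: sumr_ge0 => i _; exact: nsq_ge0.
rewrite /=; set t := \sum_(0 <= i < N) _ => t0 ts.
have tN0 := exprn_ge0 N t0; move: (t ^+ N) tN0 => tN tN0 e.
(* Since [(t - 1) * X = t^N - 1] and [0 <= t <= s < 1], one has
   [(1 - s) * X <= (1 - t) * X <= 1]. *)
have d0 : 0 < 1 - s by lra.
by rewrite -[_^-1]mul1r ler_pdivlMr//; nra.
Qed.

(** Along [wordlist] the sum is geometric, with the truncated pairing [sg] as ratio. The order of
    [z] and [w] is reversed because the inner product of [k_w] with [k_z] is [k_w(z)]. *)
Lemma gram_kz z w : ballr z -> ballr w ->
  l2dot (kz w) (kz z) = (1 - l2dot z w)^-1.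
Proof.
move=> hz hw.
have lim := ccvg_cofinal uniq_wordlist wordlist_cofinal (l2dot_cvg (l2_kz hw) (l2_kz hz)).
pose sg n := \sum_(0 <= j < n) z j * (w j)^*.
have hsg : ccvg \oo sg (l2dot z w) by exact: pairing_cvg.
set p := l2dot z w in hsg *; have p1 : `|p| < 1 by exact: ballr_pairing.
have np1 : 1 - p != 0.
  by rewrite subr_eq0; apply: contraTneq p1 => <-; rewrite normr1 ltxx.
have one : ccvg \oo (fun=> 1 : R[i]) 1 by exact: ccvg_cst.
(* The base varies with the exponent, so [r] is chosen strictly between [|p|] and [1]: eventually
   [|sg n| <= r], and [r ^+ n] tends to [0]. *)
have h0 : ccvg \oo (fun n => sg n ^+ n) 0.
  pose q := complex.Re `|p|; have qE : `|p| = q%:C by exact: normc_def_Re.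
  have q1 : q < 1 by rewrite -ltcR -qE.
  have q0 : 0 <= q by rewrite -ler0c -qE normr_ge0.
  pose r := (q + 1) / 2; have qr : q < r by rewrite /r; lra.
  have r1 : r < 1 by rewrite /r; lra.
  have r0 : 0 <= r by lra.
  have /cvgrPdist_lt cr : r ^+ n @[n --> \oo] --> (0 : R).
    by apply: cvg_expr; rewrite ger0_norm.
  apply/ccvgP => e e0; move: (cr e e0).
  have rq : 0 < r - q by lra.
  have /ccvgP/(_ _ rq) := hsg; apply: filterS2 => n h1.
  rewrite !sub0r !normrN ger0_norm ?exprn_ge0// -ltcR; apply: le_lt_trans.
  rewrite normrX rmorphXn/= lerXn2r ?nnegrE ?normr_ge0 ?ler0c//.
  have : `|sg n| <= `|p| + `|p - sg n|.
    by rewrite -[sg n in leLHS](subKr p); exact: ler_normB.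
  move=> /le_trans; apply; rewrite qE.
  have -> : r%:C = q%:C + (r - q)%:C by rewrite -rmorphD/= addrC subrK.
  by rewrite lerD2l ltW.
apply: (ccvg_unique lim); rewrite -[_^-1]mul1r -[X in X / _]subr0.
have h1 : ccvg \oo (fun n => 1 - sg n) (1 - p) by exact: (ccvgB one hsg).
have : ccvg \oo (fun n => (1 - sg n ^+ n) * (1 - sg n)^-1) ((1 - 0) / (1 - p)).
  exact: (ccvgM (ccvgB one h0) (ccvgV np1 h1)).
(* The closed form of the geometric sum divides by [1 - sg n], which is nonzero only from some rank
   on. *)
have nz : \forall n \near \oo, 1 - sg n != 0.
  have rq : 0 < complex.Re `|1 - p|.
    by rewrite -ltcR -normc_def_Re normr_gt0.
  have /ccvgP/(_ _ rq) := h1; apply: filterS => n.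
  by apply: contraTneq => ->; rewrite subr0 normc_def ltxx.
apply: cvg_trans; apply: near_eq_cvg; near=> n.
have nzn : 1 - sg n != 0 by near: n.
have := sum_wordlist (fun i => z i * (w i)^*) n; rewrite -/(sg n).
have -> : \sum_(x <- wordlist n) kz w x * (kz z x)^* =
    \sum_(x <- wordlist n) mono (fun i => z i * (w i)^*) x.
  by apply: eq_bigr => x _; rewrite /kz conjcK monoJ monoM;
    apply: eq_bigr => i _; rewrite mulrC.
move=> e; apply: (mulfI nzn); rewrite mulrCA divff// mulr1.
by rewrite -opprB -e; ring.
Unshelve. all: by end_near.
Qed.

End ball.

(** * Noncommutative power series *)

Section convolution.
Context {R : realType}.
Implicit Types (p q u v : seq nat -> R[i]).

(* Left-to-right recursion on the word for the product of noncommutative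
   power series: (p u)(w) is the sum of p(w1) u(w2) over all w = w1 ++ w2. *)
Fixpoint wconv p u (w : seq nat) : R[i] :=
  if w is i :: v then wconv (fun x => p (i :: x)) u v + p [::] * u w
  else p [::] * u [::].

Definition one_series (w : seq nat) : R[i] := (w == [::])%:R.

Lemma wconv_lin c p q u : wconv (c *: p + q) u = c *: wconv p u + wconv q u.
Proof.
apply/funext => w; elim: w p q => [|i w IH] p q.
  by rewrite /= !fctE /= /GRing.scale /=; ring.
rewrite [LHS]/= (IH (fun x => p (i :: x)) (fun x => q (i :: x))).
by rewrite /= !fctE /= /GRing.scale /=; ring.
Qed.

Lemma wconv0 u : wconv 0 u = 0.
Proof.
by apply/funext; elim=> [|i w IH] /=; rewrite ?[wconv _ _ _]IH ?add0r mul0r.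
Qed.

Lemma wconv1 u : wconv one_series u = u.
Proof.
apply/funext => -[|i w] /=; first by rewrite /one_series eqxx mul1r.
rewrite (_ : (fun x => one_series (i :: x)) = 0) ?wconv0 ?add0r; last first.
  exact/funext.
by rewrite /one_series eqxx mul1r.
Qed.

Lemma wconvA p q u : wconv p (wconv q u) = wconv (wconv p q) u.
Proof.
apply/funext => w; elim: w p q => [|i w IH] p q /=; first by rewrite mulrA.
rewrite IH; set q' := fun x => q (i :: x); set p' := fun x => p (i :: x).
(* Removing the first letter [i] from a product follows a Leibniz rule: the result is [p [::]] times
   [q'] plus the product of [p'] and [q]. *)
rewrite (_ : (fun x => _) = p [::] *: q' + wconv p' q).
  by rewrite wconv_lin !fctE /= /GRing.scale /=; ring.
by apply/funext => x; rewrite addrC.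
Qed.

(** Left shifts commute with right multiplication; hence they preserve pairs of the form
    [(q, q h)]. *)
Lemma wconv_shift a p u : wconv (wshift a p) u = wshift a (wconv p u).
Proof.
elim: a p => [|i a IH] p; first by rewrite !wshift_nil.
apply/funext => -[|j w] /=; first by rewrite !wshift_cons_nil mul0r.
rewrite wshift_cons wshift_cons_nil mul0r addr0.
have [<-|ij] := eqVneq i j.
  rewrite -IH; congr wconv.
  by apply/funext => x; rewrite wshift_cons eqxx.
rewrite (_ : (fun x => _) = 0) ?wconv0//.
by apply/funext => x; rewrite wshift_cons (negPf ij).
Qed.

(** Each coefficient of a product is a finite sum, so pointwise convergence suffices, although right
    multiplication by [u] may be unbounded on l2. *)
Lemma wconv_cvg (s : nat -> seq nat -> R[i]) p u w :
  (forall x, ccvg \oo (fun n => s n x) (p x)) ->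
  ccvg \oo (fun n => wconv (s n) u w) (wconv p u w).
Proof.
elim: w s p => [|i w IH] s p h /=; first exact: (ccvgM (h _) (ccvg_cst _)).
have hi := IH (fun n x => s n (i :: x)) (fun x => p (i :: x)) (fun x => h (i :: x)).
have h0 : ccvg \oo (fun n => s n [::] * u (i :: w)) (p [::] * u (i :: w)).
  exact: (ccvgM (h _) (ccvg_cst _)).
exact: (ccvgD hi h0).
Qed.

Definition delta (a w : seq nat) : R[i] := (w == a)%:R.

Lemma l2_deltas a : l2 (delta a).
Proof. exact: l2_delta. Qed.

Lemma delta_shift a : delta a = wshift a one_series.
Proof.
elim: a => [|i a IH]; first by rewrite wshift_nil.
apply/funext => -[|j w]; first by rewrite wshift_cons_nil.
by rewrite wshift_cons -IH /delta eqseq_cons eq_sym; case: eqP.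
Qed.

Lemma wconv_comb u s : wconv (comb delta s) u = comb (wshift ^~ u) s.
Proof.
rewrite /comb; elim: s => [|x s IH]; first by rewrite !big_nil wconv0.
by rewrite !big_cons wconv_lin IH delta_shift wconv_shift wconv1.
Qed.

End convolution.

(** * Evaluation of series at points of the ball *)

Section evaluation.
Context {R : realType}.
Implicit Types (p q u v : seq nat -> R[i]) (z : nat -> R[i]).
Local Notation F2 := (@l2_rkhs R (seq nat)).

Definition ev p z : R[i] := l2dot p (kz z).

(** The representer [kz z] is an eigenvector of the adjoint of the left shift, with eigenvalue
    [kz z a]. *)
Lemma ev_shift a u z : ballr z -> l2 u -> ev (wshift a u) z = mono z a * ev u z.
Proof.
move=> hz hu; have hk := l2_kz hz; rewrite /ev l2dot_wshift//.
rewrite (_ : kz z \o cat a = kz z a *: kz z); last first.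
  by apply/funext => w; rewrite /kz /= mono_cat rmorphM.
by have := dotZr (H := F2) (kz z a) hk hu; rewrite /= /kz conjcK.
Qed.

Lemma ev1 z : ballr z -> ev one_series z = 1.
Proof.
move=> hz; have h1 := l2_delta (R := R) ([::] : seq nat).
rewrite /ev l2dotC//; last exact: l2_kz.
rewrite l2dot_delta; last exact: l2_kz.
by rewrite /kz /mono big_nil conjcK.
Qed.

Lemma ev_comb (e : seq nat -> seq nat -> R[i]) s z : ballr z -> (forall a, l2 (e a)) ->
  ev (comb e s) z = \sum_(x <- s) x.1 * ev (e x.2) z.
Proof. by move=> hz he; exact: (dot_combl (H := F2) he _ (l2_kz hz)). Qed.

Lemma ev_comb_shift u s z : ballr z -> l2 u ->
  ev (comb (wshift ^~ u) s) z = ev (comb delta s) z * ev u z.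
Proof.
move=> hz hu; rewrite !ev_comb//; [|exact: l2_deltas|by move=> a; exact: l2_wshift].
rewrite mulr_suml; apply: eq_bigr => x _.
rewrite delta_shift !ev_shift// ?ev1// ?mulr1 ?mulrA//.
exact: l2_delta.
Qed.

(** Transferring the family [delta] to itself yields the projection of [p] to its closed span; the
    two agree at every word. *)
Lemma delta_dense p : l2 p ->
  exists c : nat -> seq (R[i] * seq nat), hcvg F2 (comb delta \o c) p.
Proof.
move=> hp.
have [l [t [[c cl _] [ml _ _ orth _]]]] :=
  transfer (H1 := F2) (H2 := F2) l2_deltas l2_deltas (fun _ _ => erefl) hp.
exists c; rewrite (_ : p = l)//; apply/funext => w; apply/eqP.
rewrite -subr_eq0; apply/eqP; rewrite -[RHS](orth w) /=.
by rewrite (l2dot_delta w (memB (H := F2) hp ml)).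
Qed.

End evaluation.

(** * Pairs of series and their shifts *)

Section pairs.
Context {R : realType}.
Local Notation F2 := (@l2_rkhs R (seq nat)).
Local Notation G := (@l2_rkhs R (bool * seq nat)%type).
Implicit Types (p q u v : seq nat -> R[i]) (f g : bool * seq nat -> R[i]).

(** The direct sum of two Fock spaces is coded as l2 over [bool * seq nat], again an [l2_rkhs];
    [false] marks the first component. *)
Definition cmp (b : bool) f w : R[i] := f (b, w).

Definition mkpair p q : bool * seq nat -> R[i] :=
  fun x => if x.1 then q x.2 else p x.2.

Definition embed_psi b (x : bool * seq nat) := if x.1 == b then Some x.2 else None.

Lemma embed_psiK b w : embed_psi b (b, w) = Some w.
Proof. by rewrite /embed_psi eqxx. Qed.

Lemma psiK_embed b x w : embed_psi b x = Some w -> (b, w) = x.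
Proof. by case: x => b' v; rewrite /embed_psi /=; case: eqP => // -> [->]. Qed.

Definition embed b p := push (embed_psi b) p.

Lemma l2_embed b p : l2 p -> l2 (embed b p).
Proof. exact: (l2_push (@psiK_embed b)). Qed.

Lemma l2_cmp b f : l2 f -> l2 (cmp b f).
Proof. exact: (l2_pull (@embed_psiK b)). Qed.

Lemma l2dot_embed b p f : l2 p -> l2 f -> l2dot (embed b p) f = l2dot p (cmp b f).
Proof. exact: (l2dot_push (@embed_psiK b) (@psiK_embed b)). Qed.

Lemma mkpair_embed p q : mkpair p q = embed false p + embed true q.
Proof.
by apply/funext => -[[] w]; rewrite /mkpair /embed /push /embed_psi !fctE /= ?addr0 ?add0r.
Qed.

Lemma mkpair_cmp f : mkpair (cmp false f) (cmp true f) = f.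
Proof. by apply/funext => -[[] w]. Qed.

Lemma l2_mkpair p q : l2 p -> l2 q -> l2 (mkpair p q).
Proof.
by move=> hp hq; rewrite mkpair_embed; apply: (memD (H := G)); exact: l2_embed.
Qed.

Lemma hnorm_cmp f : l2 f ->
  hnorm G f ^+ 2 = hnorm F2 (cmp false f) ^+ 2 + hnorm F2 (cmp true f) ^+ 2.
Proof.
move=> hf; rewrite (hnorm_Re (H := G))// !(hnorm_Re (H := F2)) /=; try exact: l2_cmp.
rewrite -!l2dot_embed//; try exact: l2_cmp.
have hi b : l2 (embed b (cmp b f)) by exact/l2_embed/l2_cmp.
have := dotDl (H := G) (hi false) (hi true) hf.
by rewrite -mkpair_embed mkpair_cmp /= => ->; rewrite raddfD.
Qed.

Definition gpsi a (x : bool * seq nat) := omap (pair x.1) (strip a x.2).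

Lemma gpsiK a (x : bool * seq nat) : gpsi a (x.1, a ++ x.2) = Some x.
Proof. by rewrite /gpsi /= strip_cat; case: x. Qed.

Lemma psiK_g a (x y : bool * seq nat) : gpsi a x = Some y -> (y.1, a ++ y.2) = x.
Proof.
rewrite /gpsi; case: x => b w /=; case E: strip => [v|]//= [<-] /=.
by rewrite (cat_strip E).
Qed.

Definition gshift a f := push (gpsi a) f.

Lemma l2_gshift a f : l2 f -> l2 (gshift a f).
Proof. exact: (l2_push (@psiK_g a)). Qed.

Lemma l2dot_gshift a f g : l2 f -> l2 g ->
  l2dot (gshift a f) g = l2dot f (fun x => g (x.1, a ++ x.2)).
Proof. exact: (l2dot_push (@gpsiK a) (@psiK_g a)). Qed.

Lemma gshiftE a f b w : gshift a f (b, w) = wshift a (cmp b f) w.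
Proof. by rewrite /gshift /wshift /push /gpsi /=; case: strip. Qed.

Lemma gshift_nil f : gshift [::] f = f.
Proof. by apply/funext => -[]. Qed.

Lemma gshift_cons i a f : gshift (i :: a) f = gshift [:: i] (gshift a f).
Proof.
apply/funext => -[b [|j w]]; first by rewrite !gshiftE !wshift_cons_nil.
by rewrite !gshiftE !wshift_cons wshift_nil; case: eqP => //; rewrite /cmp gshiftE.
Qed.

End pairs.

(** * The factorization *)

Section orthonormal_shifts.
Context {R : realType}.
Local Notation F2 := (@l2_rkhs R (seq nat)).
Local Notation G := (@l2_rkhs R (bool * seq nat)%type).
Implicit Types (p q u : seq nat -> R[i]) (f : bool * seq nat -> R[i]).
Context (om : bool * seq nat -> R[i]).
Hypothesis l2om : l2 om.
Hypothesis orthonormal : forall a b,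
  l2dot (gshift a om) (gshift b om) = (a == b)%:R.

Definition gconv p : bool * seq nat -> R[i] :=
  mkpair (wconv p (cmp false om)) (wconv p (cmp true om)).

Lemma gconvE p b w : gconv p (b, w) = wconv p (cmp b om) w.
Proof. by case: b. Qed.

Lemma gram_delta (a b : seq nat) :
  dot F2 (delta a) (delta b) = dot G (gshift a om) (gshift b om).
Proof.
rewrite /= orthonormal (l2dot_delta b (l2_deltas a)).
by rewrite /delta eq_sym.
Qed.

Lemma gconv_comb s : comb (gshift ^~ om) s = gconv (comb delta s).
Proof.
apply/funext => -[b w]; rewrite gconvE wconv_comb !combE.
by apply: eq_bigr => x _; rewrite gshiftE.
Qed.

(** Norm convergence gives convergence at each word, where [wconv_cvg] identifies the limit. *)
Lemma hcvg_gconv (c : nat -> seq (R[i] * seq nat)) p f : l2 p -> l2 f ->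
  hcvg F2 (comb delta \o c) p -> hcvg G (comb (gshift ^~ om) \o c) f -> f = gconv p.
Proof.
move=> hp hf cp cf; apply/funext => -[b w]; rewrite gconvE.
have mc n := mem_comb (H := F2) l2_deltas (c n).
have mc' n := mem_comb (H := G) (fun a => l2_gshift a l2om) (c n).
apply: (ccvg_unique (hcvg_eval (H := G) (x := (b, w)) hf mc' cf)).
have := wconv_cvg (u := cmp b om) (w := w) (fun x => hcvg_eval (H := F2) (x := x) hp mc cp).
by apply: eq_ccvg => n /=; rewrite gconv_comb gconvE.
Qed.

(** The isometry sending [delta a] to [gshift a om] must send [p] to the product of [p] and [om].
    Evaluation is multiplicative when [p] is a polynomial, and in general by continuity. *)
Lemma gconv_mult p : l2 p -> [/\ l2 (gconv p), hnorm G (gconv p) <= hnorm F2 p &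
  forall b z, ballr z -> ev (cmp b (gconv p)) z = ev p z * ev (cmp b om) z].
Proof.
move=> hp; have ms a := l2_gshift a l2om.
have [l [t [[c cl ct] [ml mt le orth _]]]] :=
  transfer (H1 := F2) (H2 := G) l2_deltas ms gram_delta hp.
have pl : p = l.
  apply/funext => w; apply/eqP; rewrite -subr_eq0; apply/eqP.
  rewrite -[RHS](orth w) /=.
  by rewrite (l2dot_delta w (memB (H := F2) hp ml)).
subst l; have E := hcvg_gconv hp mt cl ct; subst t; split => // b z hz.
have hk := l2_kz hz; have hi := l2_embed b hk.
have mc n := mem_comb (H := F2) l2_deltas (c n).
have mc' n := mem_comb (H := G) ms (c n).
have evE f : l2 f -> ev (cmp b f) z = l2dot f (embed b (kz z)).
  move=> hf; rewrite /ev l2dotC//; last exact: l2_cmp.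
  by rewrite -l2dot_embed// -l2dotC.
rewrite evE//; apply: (ccvg_unique (hcvg_dot (H := G) mt mc' hi ct)).
have h := hcvg_dot (H := F2) hp mc hk cl.
have : ccvg \oo (fun n => dot F2 ((comb delta \o c) n) (kz z) * ev (cmp b om) z)
    (ev p z * ev (cmp b om) z) by exact: (ccvgM h (ccvg_cst _)).
apply: eq_ccvg => n /=; rewrite -evE; last exact: mc'.
rewrite gconv_comb (_ : cmp b (gconv _) = comb (wshift ^~ (cmp b om)) (c n)).
  by rewrite ev_comb_shift//; exact: l2_cmp.
by rewrite -wconv_comb; apply/funext => w; rewrite /cmp gconvE.
Qed.

End orthonormal_shifts.

(** * The wandering vector and the inverse series *)

Section wandering.
Context {R : realType}.
Local Notation F2 := (@l2_rkhs R (seq nat)).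
Local Notation G := (@l2_rkhs R (bool * seq nat)%type).
Implicit Types (p q u : seq nat -> R[i]) (f : bool * seq nat -> R[i]).
Context (h : seq nat -> R[i]).
Hypothesis l2h : l2 h.

(** The graph of right multiplication by [h]. As the product may leave l2, [l2 (pr q)] is stated
    wherever it is used. *)
Definition pr q : bool * seq nat -> R[i] := mkpair q (wconv q h).

Lemma pr_lin c p q : pr (c *: p + q) = c *: pr p + pr q.
Proof. by apply/funext => -[[] w]; rewrite /pr /mkpair /= ?wconv_lin. Qed.

Lemma pr_shift a q : gshift a (pr q) = pr (wshift a q).
Proof.
by apply/funext => -[[] w]; rewrite gshiftE /pr /mkpair /= ?wconv_shift.
Qed.

Lemma pr1 : pr one_series = mkpair one_series h.
Proof. by rewrite /pr wconv1. Qed.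

Lemma l2_pr1 : l2 (pr one_series).
Proof. by rewrite pr1; apply: l2_mkpair => //; exact: l2_delta. Qed.

Lemma hnorm_pr1 : hnorm G (pr one_series) ^+ 2 = 1 + hnorm F2 h ^+ 2.
Proof.
rewrite hnorm_cmp; last exact: l2_pr1.
rewrite pr1; congr (_ + _).
have l1 := l2_delta (R := R) ([::] : seq nat).
by rewrite (hnorm_Re (H := F2))//= l2dot_delta// eqxx.
Qed.

(* [pr a] is the normalized component of [(1, h)] orthogonal to the subspace
   of the [(q, q h)] with [q] vanishing at the empty word. *)
Lemma wandering_vector : exists a, [/\ l2 (pr a), l2dot (pr a) (pr a) = 1,
  a [::] != 0 & forall q, l2 (pr q) -> q [::] = 0 -> l2dot (pr a) (pr q) = 0].
Proof.
pose W := [set f | exists q, [/\ l2 f, f = pr q & q [::] = 0]].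
have [l [s [ml Ws sl] orth]] : exists l, exists2 s,
    [/\ l2 l, (forall n, W (s n)) & hcvg G s l] &
    forall w, W w -> dot G (pr one_series - l) w = 0.
  apply: (projection (H := G)).
  - by move=> f [q []].
  - exists 0; split => //; first exact: l20.
    by apply/funext => -[[] w]; rewrite /pr /mkpair /= ?wconv0.
  - move=> c f1 f2 [p [hp E1 p0]] [q [hq E2 q0]]; exists (c *: p + q).
    split; [exact: (mem_lin (H := G))|by rewrite pr_lin E1 E2|].
    by rewrite !fctE /= p0 q0 addr0; exact: mulr0.
  - exact: l2_pr1.
have ms n : l2 (s n) by have [q []] := Ws n.
have lim x := hcvg_eval (H := G) (x := x) ml ms sl.
(* The limit of members of [W] is still of the form [(q, q h)], since coefficients of products pass
   to pointwise limits. *)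
have lW : l = pr (cmp false l).
  apply/funext => -[[] w] //; apply: (ccvg_unique (lim (true, w))).
  have := wconv_cvg (u := h) (w := w) (fun x => lim (false, x)).
  apply: eq_ccvg => n; have [q [_ -> _]] := Ws n.
  by rewrite /pr /mkpair.
have l0 : l (false, [::]) = 0.
  apply: (ccvg_unique (lim (false, [::]))).
  apply: (@eq_ccvg _ _ _ (fun=> 0)); last exact: ccvg_cst.
  by move=> n; have [q [_ -> q0]] := Ws n; rewrite /pr /mkpair /= q0.
pose v := pr one_series - l.
have mv : l2 v by apply: (memB (H := G)) => //; exact: l2_pr1.
have vE : v = pr (-1 *: cmp false l + one_series).
  by rewrite pr_lin -lW scaleN1r addrC.
(* The constant term [1] forces [v] to have norm at least [1], so it can be normalized. *)
have v0 : v (false, [::]) = 1.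
  by rewrite /v !fctE /= l0 subr0.
pose N := hnorm G v.
have N1 : 1 <= N ^+ 2.
  rewrite /N (hnorm_Re (H := G) mv)/=; have := nsq_le_l2dot (false, [::]) mv.
  by rewrite v0 /nsq /= expr1n expr0n addr0.
have N0 : N != 0 by apply: contraTneq N1 => ->; rewrite expr0n ler10.
pose a := N^-1%:C *: (-1 *: cmp false l + one_series).
have aE : pr a = N^-1%:C *: v.
  by rewrite /a -[N^-1%:C *: _]addr0 pr_lin -vE; apply/funext => -[[] w];
    rewrite !fctE /pr /mkpair /= ?wconv0 addr0.
have ma : l2 (pr a) by rewrite aE; exact: (memZ (H := G)).
exists a; split => //.
- have := dot_hnormX (H := G) ma; rewrite /= => ->.
  rewrite aE hnormZ// -/N normc_def /= expr0n addr0 sqrtr_sqr -rmorphM -rmorphXn/=.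
  by rewrite ger0_norm ?invr_ge0 ?hnorm_ge0// mulVf// expr1n.
- have -> : a [::] = pr a (false, [::]) by [].
  rewrite aE [X in X != _](_ : _ = N^-1%:C * v (false, [::]))// v0 mulr1.
  by rewrite eq_complex /= eqxx andbT invr_eq0.
- move=> q hq q0; rewrite aE.
  have := dotZl (H := G) N^-1%:C mv hq; rewrite /= => ->.
  have -> : l2dot v (pr q) = 0 by apply: orth; exists q.
  by rewrite mulr0.
Qed.

Context (a : seq nat -> R[i]).
Hypothesis ma : l2 (pr a).
Hypothesis na : l2dot (pr a) (pr a) = 1.
Hypothesis a0 : a [::] != 0.
Hypothesis wand : forall q, l2 (pr q) -> q [::] = 0 -> l2dot (pr a) (pr q) = 0.

Lemma dot_wand q : l2 (pr q) -> l2dot (pr q) (pr a) = q [::] / a [::].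
Proof.
(* This [c] cancels the constant term of [c *: a + q], which [wand] then makes orthogonal to
   [pr a]. *)
move=> hq; pose c := - (q [::] / a [::]).
have hr : l2 (pr (c *: a + q)) by rewrite pr_lin; exact: (mem_lin (H := G)).
have := wand hr; rewrite l2dotC// pr_lin => w0.
have {}w0 : (l2dot (c *: pr a + pr q) (pr a))^* = 0.
  by apply: w0; rewrite !fctE /= /c /GRing.scale /= mulNr divfK// addNr.
have := dot_linl (H := G) c ma hq ma; rewrite /= na mulr1 => E.
have : l2dot (c *: pr a + pr q) (pr a) = 0 by apply/eqP; rewrite -conjc_eq0 w0.
by rewrite E => /eqP; rewrite addrC addr_eq0 opprK => /eqP.
Qed.

(** Cancelling common first letters leaves two empty words, distinct first letters, or one empty
    word; in the last case the other shift has no constant term. *)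
Lemma wand_orthonormal b c : l2dot (gshift b (pr a)) (gshift c (pr a)) = (b == c)%:R.
Proof.
have ms x := l2_gshift x ma.
have w0 x i : l2dot (gshift (i :: x) (pr a)) (pr a) = 0.
  by rewrite pr_shift dot_wand ?wshift_cons_nil ?mul0r// -pr_shift.
elim: b c => [|i b IH] [|j c].
- by rewrite !gshift_nil na eqxx.
- by rewrite gshift_nil l2dotC// w0 conjc0.
- by rewrite gshift_nil w0.
- rewrite (gshift_cons i) l2dot_gshift//.
  rewrite (_ : (fun x => _) = if j == i then gshift c (pr a) else 0).
    have [->|ji] := eqVneq j i; first by rewrite eqseq_cons eqxx IH.
    by rewrite eqseq_cons eq_sym (negPf ji); exact: (dot0r (H := G) (ms b)).
  apply/funext => -[e w]; rewrite /= gshiftE wshift_cons; case: eqP => //.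
  by rewrite gshiftE.
Qed.

(** Orthogonality to [pr a] kills the constant term of [r]; the series left after removing a first
    letter inherits both hypotheses. *)
Lemma wand_total (r : seq nat -> R[i]) w : l2 (pr r) ->
  (forall b, l2dot (pr r) (gshift b (pr a)) = 0) -> r w = 0.
Proof.
have ms x := l2_gshift x ma.
elim: w r => [|i w IH] r hr orth.
  have := orth [::]; rewrite gshift_nil dot_wand// => /eqP.
  by rewrite mulf_eq0 invr_eq0 (negPf a0) orbF => /eqP.
have r0 : r [::] = 0.
  have := orth [::]; rewrite gshift_nil dot_wand// => /eqP.
  by rewrite mulf_eq0 invr_eq0 (negPf a0) orbF => /eqP.
pose r' x := r (i :: x).
(* Because [r [::] = 0], the extra term [r [::] * h (i :: x)] in the second component disappears. *)
have rE : pr r' = (fun x => pr r (x.1, [:: i] ++ x.2)).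
  by apply/funext => -[[] x] //; rewrite /pr /mkpair /= r0 mul0r addr0.
have hr' : l2 (pr r') by rewrite rE; exact: (l2_pull (gpsiK [:: i]) hr).
apply: (IH r') => // b; rewrite l2dotC// rE -l2dot_gshift//.
by rewrite -gshift_cons l2dotC// orth conjc0 conjc0.
Qed.

(** Transfer now runs from the shifts of [pr a] back to [delta]: [g] lists the coefficients of the
    projection of [(1, h)]. *)
Lemma wand_inverse : exists g, [/\ l2 g,
  hnorm F2 g ^+ 2 <= 1 + hnorm F2 h ^+ 2 & gconv (pr a) g = pr one_series].
Proof.
have ms x := l2_gshift x ma; have m1 := l2_pr1.
have [l [g [[c cl cg] [ml mg le orth _]]]] :=
  transfer (H1 := G) (H2 := F2) ms l2_deltas
    (fun x y => esym (gram_delta wand_orthonormal x y)) m1.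
exists g; split => //.
  by rewrite -hnorm_pr1 ler_pXn2r ?nnegrE ?hnorm_ge0.
have lE : l = gconv (pr a) g by exact: (hcvg_gconv ma mg ml cg cl).
have lpr : l = pr (wconv g a).
  rewrite lE; apply/funext => -[b w]; rewrite gconvE /pr /mkpair /=.
  by case: b; rewrite -?wconvA.
(* By associativity [l] has the form [(q, q h)], hence so does the remainder, and [wand_total]
   annihilates it. *)
have E : pr one_series - l = pr (-1 *: wconv g a + one_series).
  by rewrite pr_lin -lpr scaleN1r addrC.
have mr := memB (H := G) m1 ml; rewrite E in mr orth.
rewrite -lE; apply/eqP; rewrite eq_sym -subr_eq0 E.
rewrite (_ : -1 *: _ + _ = 0).
  by apply/eqP/funext => -[[] w]; rewrite /pr /mkpair /= ?wconv0.
by apply/funext => w; exact: (wand_total w mr orth).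
Qed.

End wandering.

(** * Passage between the Fock space and the Drury-Arveson space *)

Section drury_arveson.
Context {R : realType} {d : option nat} (H2d : rkhs (@da_kernel R d)).
Local Notation F2 := (@l2_rkhs R (seq nat)).
Implicit Types (p : seq nat -> R[i]).

Lemma cball_ballr (z : cball R d) : ballr (set_val z).
Proof. by apply: ball_setP; exact: set_valP. Qed.

Lemma gram_da (x y : cball R d) :
  dot F2 (kz (set_val x)) (kz (set_val y)) =
  dot H2d (fun z => da_kernel z x) (fun z => da_kernel z y).
Proof.
rewrite rkhs_reproducing; last exact: rkhs_kernel.
rewrite /= gram_kz; [|exact: cball_ballr..].
by rewrite /da_kernel pairingE//; exact: cball_ballr.
Qed.

Definition evd p (z : cball R d) : R[i] := ev p (set_val z).

(** The representers [kz] and the kernel functions have the same Gram matrix; the reproducing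
    property identifies the transfer of [p] with [evd p]. *)
Lemma evd_mem p : l2 p -> carrier H2d (evd p) /\ hnorm H2d (evd p) <= hnorm F2 p.
Proof.
move=> hp; have mk z := l2_kz (cball_ballr z).
have [l [t [_ [_ mt le _ tE]]]] :=
  transfer (H1 := F2) (H2 := H2d) mk (rkhs_kernel H2d) gram_da hp.
suff -> : evd p = t by [].
by apply/funext => z; rewrite -(rkhs_reproducing z mt) tE.
Qed.

(** The same transfer in the opposite direction gives a lift in the closed span of the representers,
    without increase of norm. *)
Lemma evd_lift f : carrier H2d f ->
  exists p, [/\ l2 p, hnorm F2 p <= hnorm H2d f & evd p = f].
Proof.
move=> hf; have mk z := l2_kz (cball_ballr z).
have [l [t [_ [_ mt le _ tE]]]] :=
  transfer (H1 := H2d) (H2 := F2) (rkhs_kernel H2d) mk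
    (fun x y => esym (gram_da x y)) hf.
exists t; split => //; apply/funext => z.
by rewrite -(rkhs_reproducing z hf) -tE.
Qed.

End drury_arveson.

Theorem theorem1p1 (R : realType) (d : option nat) (hd : d <> Some 0%N)
    (H2d : rkhs (@da_kernel R d)) (h : cball R d -> R[i]) (hh : carrier H2d h) :
  exists a b : cball R d -> R[i],
    [/\ Mult H2d a /\ Mult H2d b,
        outer H2d a,
        forall z, a z != 0 /\ h z = b z / a z,
        forall f, carrier H2d f ->
          hnorm H2d (fun z => a z * f z) ^+ 2 +
          hnorm H2d (fun z => b z * f z) ^+ 2 <= hnorm H2d f ^+ 2 &
        carrier H2d (fun z => (a z)^-1) /\
        hnorm H2d (fun z => (a z)^-1) ^+ 2 <= 1 + hnorm H2d h ^+ 2].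
Proof.
have [p [mp ph pE]] := evd_lift hh.
have [q [mq nq q0 wand]] := wandering_vector mp.
have [g [mg gle gE]] := wand_inverse mp mq nq q0 wand.
have on := wand_orthonormal mq nq q0 wand.
pose a := evd (d := d) (cmp false (pr p q)).
pose b := evd (d := d) (cmp true (pr p q)).
have [_ _ gev] := gconv_mult mq on mg.
have ga z : evd g z * a z = 1.
  have hz := cball_ballr z; rewrite /evd -gev// gE pr1.
  exact: (ev1 hz).
have gb z : evd g z * b z = h z.
  have hz := cball_ballr z; rewrite /evd -gev// gE pr1 -pE.
  by [].
have a0 z : a z != 0.
  by apply: contraTneq (oner_neq0 R[i]) => az; rewrite -(ga z) az mulr0 eqxx.
have aV : (fun z => (a z)^-1) = evd g.
  by apply/funext => z; apply: (mulIf (a0 z)); rewrite ga mulVf.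
have [mgd gd] := evd_mem H2d mg.
(* Lift [f] to [u], multiply the wandering pair by [u] and evaluate both components; none of the
   three operations increases the norm. *)
have mult f : carrier H2d f ->
  [/\ carrier H2d (fun z => a z * f z), carrier H2d (fun z => b z * f z) &
    hnorm H2d (fun z => a z * f z) ^+ 2 + hnorm H2d (fun z => b z * f z) ^+ 2
      <= hnorm H2d f ^+ 2].
  move=> /evd_lift[u [mu uf uE]]; have [mc cle cev] := gconv_mult mq on mu.
  have E e : evd (cmp e (gconv (pr p q) u)) =
      (fun z => evd (cmp e (pr p q)) z * f z).
    apply/funext => z; rewrite /evd cev; last exact: cball_ballr.
    by rewrite mulrC -uE.
  have [m1 n1] := evd_mem H2d (l2_cmp false mc).
  have [m2 n2] := evd_mem H2d (l2_cmp true mc).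
  rewrite E in m1 n1; rewrite E in m2 n2; split => //.
  apply: (@le_trans _ _ (hnorm (@l2_rkhs R _) u ^+ 2)); last first.
    by rewrite ler_pXn2r ?nnegrE ?hnorm_ge0.
  apply: (@le_trans _ _ (hnorm (@l2_rkhs R _) (gconv (pr p q) u) ^+ 2)); last first.
    by rewrite ler_pXn2r ?nnegrE ?hnorm_ge0.
  by rewrite hnorm_cmp// lerD// ler_pXn2r ?nnegrE ?hnorm_ge0.
exists a, b; split.
- by split=> f /mult[].
- move=> f /evd_lift[u [mu _ uE]] e e0.
  have [c cu] := delta_dense mu.
  have /cvgrPdist_lt/(_ e e0)[n _ /(_ n (leqnn n))] := cu.
  rewrite /= sub0r normrN ger0_norm ?hnorm_ge0// => hn.
  have mdel := mem_comb (H := @l2_rkhs R (seq nat)) l2_deltas (c n).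
  have msh := mem_comb (H := @l2_rkhs R (seq nat)) (fun x => l2_wshift x mg) (c n).
  have mdiff := memB (H := @l2_rkhs R (seq nat)) mdel mu.
  have [mev _] := evd_mem H2d msh.
  (* The witness evaluates the product of a polynomial near [u] with [g]; since [a] times [evd g] is
     [1], multiplying it by [a] returns the polynomial. *)
  exists (evd (comb (wshift ^~ g) (c n))) => //.
  have -> : (fun z => a z * evd (comb (wshift ^~ g) (c n)) z - f z) =
      evd (comb delta (c n) - u).
    apply/funext => z; have hz := cball_ballr z.
    have ag : a z * ev g (set_val z) = 1 by rewrite mulrC; exact: ga.
    change (a z * ev (comb (wshift ^~ g) (c n)) (set_val z) - f z =
      ev (comb delta (c n) - u) (set_val z)).
    rewrite ev_comb_shift// mulrCA ag mulr1.
    by rewrite -uE; have := dotBl (H := @l2_rkhs R (seq nat)) mdel mu (l2_kz hz) => /= <-.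
  by apply: le_lt_trans hn; have [] := evd_mem H2d mdiff.
- move=> z; split=> //; apply: (mulIf (a0 z)); rewrite divfK// -(gb z).
  by rewrite -mulrA [b z * _]mulrC mulrA ga mul1r.
- by move=> f /mult[].
- rewrite aV; split => //.
  apply: (@le_trans _ _ (hnorm (@l2_rkhs R _) g ^+ 2)).
    by rewrite ler_pXn2r ?nnegrE ?hnorm_ge0.
  by apply: (le_trans gle); rewrite lerD2l ler_pXn2r ?nnegrE ?hnorm_ge0.
Qed.
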